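(* Let $n\ge 7$ be an integer. If $\mathcal{F}\subseteq\binom{[n]}{3}$ has VC-dimension at most $2$, then $|\mathcal{F}|\le\binom{n-1}{2}+1$.
   Context: Here $[n]=\{1,\dots,n\}$ and $\binom{[n]}{3}$ denotes the collection of all $3$-element subsets of $[n]$. A set system $\mathcal{F}\subseteq 2^{X}$ shatters $S\subseteq X$ if $\{F\cap S: F\in\mathcal{F}\}=2^{S}$, i.e. every subset of $S$ is the intersection of $S$ with some member of $\mathcal{F}$. The VC-dimension of $\mathcal{F}$ is the largest integer $d$ such that some $S\subseteq X$ with $|S|=d$ is shattered by $\mathcal{F}$; ''VC-dimension at most $2$'' means that no $3$-element subset of $[n]$ is shattered by $\mathcal{F}$. *)

(* Defs.v *)
From mathcomp Require Import all_boot.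
Set Implicit Arguments.
Unset Strict Implicit.
Unset Printing Implicit Defensive.

Definition shatters (T : finType) (F : {set {set T}}) (S : {set T}) : bool :=
  [set A :&: S | A in F] == powerset S.

(* The empty family shatters no set, not even set0; the maximum over the empty
   range gives it VC-dimension 0. *)
Definition VCdim (T : finType) (F : {set {set T}}) : nat :=
  \max_(S : {set T} | shatters F S) #|S|.

(* Main.v *)
Require Import Defs.
From mathcomp Require Import all_boot.
From mathcomp Require Import zify.

(** Call the reason of a member abc of F a subset B of abc that is not the trace
    of any member.  It is empty (every member meets abc), a point a (every member
    through a meets bc), or a pair ab (abc is the only member containing ab).

    If |F| > C(n-1,2), the pigeonhole principle gives a nonempty A in F covering an
    even number of times each of the C(n-1,2) pairs that avoid a fixed point, hence
    every pair; then no member of A has a pair as a reason.  If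
    |F| >= C(n-1,2) + 2, such a "core" A can moreover avoid any prescribed member.
    By induction on n, deleting a point, all degrees are at least n-1 when n >= 8.

    If some abc has an empty reason, a core avoiding abc yields one of four small
    configurations around abc, each refuted by bounding a link.  Otherwise every
    core contains a complete K4 whose four triples have point reasons; two
    different K4s must be disjoint, and double counting the degrees of their eight
    points gives a contradiction, so there is only one K4, and a core avoiding one
    of its triples cannot exist.  For n = 7 the same configurations are refuted by
    an exhaustive search over reasons. *)

Set Implicit Arguments.
Unset Strict Implicit.
Unset Printing Implicit Defensive.

(** * Triples and reasons *)

Section Families.
Variable T : finType.
Implicit Types (F A : {set {set T}}) (S B V : {set T}).

Definition misses F S B := forall S', S' \in F -> S' :&: S != B.

Definition unshattered F :=
  forall S, S \in F -> exists2 B : {set T}, B \subset S & misses F S B.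

(** Traces on a member are always subsets of it, so a member that is not shattered has a subset that
    is not a trace. *)
Lemma VCdim_unshattered F k :
  (forall S, S \in F -> #|S| = k.+1) -> VCdim F <= k -> unshattered F.
Proof.
move=> unif vc S SF.
have: ~~ shatters F S.
  apply: contraL vc => sh; rewrite -ltnNge -(unif S SF).
  exact: (leq_bigmax_cond (F := fun S : {set T} => #|S|) _ sh).
rewrite /shatters eqEsubset negb_and => /orP[/subsetPn[B /imsetP[A _ ->]]|].
  by rewrite powersetE subsetIr.
case/subsetPn=> B; rewrite powersetE => BS Bn; exists B => // S' S'F.
by apply: contraNneq Bn => <-; apply/imsetP; exists S'.
Qed.

Definition tri F x y z := [set x; y; z] \in F.

(* The reason of abc is empty, {a}, {a, b}, respectively. *)
Definition T0 F a b c := forall x y z, tri F x y z ->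
  (x = a \/ x = b \/ x = c) \/ (y = a \/ y = b \/ y = c) \/
  (z = a \/ z = b \/ z = c).
Definition T1 F a b c := forall x y, tri F a x y ->
  (x = b \/ x = c) \/ (y = b \/ y = c).
Definition T2 F a b c := forall x, tri F a b x -> x = c.

Definition isK4 F (Q : {set T}) := #|Q| = 4 /\
  forall x y z, x \in Q -> y \in Q -> z \in Q -> x <> y -> x <> z -> y <> z ->
    tri F x y z.

Section Triples.
Variable F : {set {set T}}.
Hypothesis unif : forall S, S \in F -> #|S| = 3.

Local Notation t := (tri F).

Lemma tri_swap12 x y z : t x y z -> t y x z.
Proof. by rewrite /tri [[set y; x]]setUC. Qed.

Lemma tri_swap23 x y z : t x y z -> t x z y.
Proof. by rewrite /tri -!setUA [[set z] :|: _]setUC. Qed.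

Lemma tri_swap13 x y z : t x y z -> t z y x.
Proof. by move/tri_swap12/tri_swap23/tri_swap12. Qed.

Lemma tri_rotl x y z : t x y z -> t y z x.
Proof. by move/tri_swap12/tri_swap23. Qed.

Lemma tri_rotr x y z : t x y z -> t z x y.
Proof. by move/tri_swap23/tri_swap12. Qed.

Lemma tri_neq x y z : t x y z -> [/\ x <> y, x <> z & y <> z].
Proof.
move/unif; rewrite -setUA !cardsU1 cards1 !inE => h; split=> e; subst;
  move: h; rewrite ?eqxx ?orbT /=; lia.
Qed.

Lemma triP S a : S \in F -> a \in S -> exists x y, S = [set a; x; y].
Proof.
move=> SF aS; move/eqP: (unif SF); rewrite (cardsD1 a) aS eqSS => /cards2P[x [y [_ e]]].
by exists x, y; rewrite -setUA -e setD1K.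
Qed.

Lemma triP0 S : S \in F -> exists x y z, S = [set x; y; z].
Proof.
move=> SF; have /card_gt0P[a aS] : 0 < #|S| by rewrite unif.
by have [x [y ->]] := triP SF aS; exists a, x, y.
Qed.

End Triples.
End Families.

Ltac perm3 :=
  first [ assumption | apply: tri_swap12; assumption | apply: tri_swap23; assumption
        | apply: tri_swap13; assumption | apply: tri_rotl; assumption
        | apply: tri_rotr; assumption ].

Section Reasons.
Variable T : finType.
Variable F : {set {set T}}.
Implicit Types (S B V : {set T}).
Hypothesis unif : forall S, S \in F -> #|S| = 3.
Hypothesis uns : unshattered F.

Local Notation t := (tri F).

Lemma misses_outside S B S' : misses F S B -> B \subset S -> S' \in F ->
  B \subset S' -> exists i, [/\ i \in S', i \in S & i \notin B].
Proof.
move=> mis BS S'F BS'; have := mis _ S'F; rewrite eq_sym eqEsubset subsetI BS BS'.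
by case/subsetPn=> i; rewrite inE => /andP[? ?] ?; exists i.
Qed.

Local Ltac incl inB aB bB cB := let i := fresh in let iB := fresh in
  apply/subsetP=> i iB; move: (iB); case: (inB i iB) => [->|[->|->]];
  rewrite ?aB ?bB ?cB // !inE eqxx ?orbT.
Local Ltac outs aB bB cB := let e1 := fresh in let e2 := fresh in
  case; rewrite !inE => /orP[/orP[]|] /eqP e1 /orP[/orP[]|] /eqP e2;
  rewrite e2 ?aB ?bB ?cB // => _; move: e1; rewrite e2 => e1;
  solve [congruence | tauto | intuition congruence].

(** Each membership pattern of [a], [b], [c] in the missed set [B] gives one alternative; the
    pattern [B] = abc is impossible, as abc is its own trace. *)
Lemma reason a b c : t a b c ->
  T0 F a b c \/ (T1 F a b c \/ T1 F b a c \/ T1 F c a b) \/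
  (T2 F a b c \/ T2 F a c b \/ T2 F b c a).
Proof.
move=> tabc; have [B BS mis] := uns tabc; have key := misses_outside mis BS.
have [ab ac bc] := tri_neq unif tabc.
have inB i : i \in B -> i = a \/ i = b \/ i = c.
  by move/(subsetP BS); rewrite !inE => /orP[/orP[]|] /eqP; tauto.
case aB: (a \in B); case bB: (b \in B); case cB: (c \in B).
- suff e : B = [set a; b; c] by case/eqP: (mis _ tabc); rewrite setIid.
  apply/eqP; rewrite eqEsubset BS; apply/subsetP=> i.
  by rewrite !inE => /orP[/orP[]|] /eqP->.
- by right; right; left=> x tx; have [|i] := key _ tx; [incl inB aB bB cB|outs aB bB cB].
- by right; right; right; left=> x tx; have [|i] := key _ (tri_swap23 tx); [incl inB aB bB cB|outs aB bB cB].
- by right; left; left=> x y tx; have [|i] := key _ tx; [incl inB aB bB cB|outs aB bB cB].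
- by right; right; right; right=> x tx; have [|i] := key _ (tri_rotr tx); [incl inB aB bB cB|outs aB bB cB].
- by right; left; right; left=> x y tx; have [|i] := key _ tx; [incl inB aB bB cB|outs aB bB cB].
- by right; left; right; right=> x y tx; have [|i] := key _ tx; [incl inB aB bB cB|outs aB bB cB].
- by left=> x y z tx; have [|i] := key _ tx; [incl inB aB bB cB|outs aB bB cB].
Qed.
End Reasons.

(** * Cores *)

Section Cores.
Variable T : finType.
Implicit Types (F A B : {set {set T}}) (S e V : {set T}).

Definition core A := forall x y z, tri A x y z ->
  exists2 z', z' <> z & tri A x y z'.

Definition codeg A e := #|[set S in A | e \subset S]|.

Lemma codegE A e : codeg A e = \sum_(S in A) (e \subset S).
Proof.
rewrite /codeg -sum1_card big_mkcond [RHS]big_mkcond; apply: eq_bigr => S _.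
by rewrite inE; case: (S \in A); case: (e \subset S).
Qed.

(** Members lying in both families are counted twice on the right, hence do not affect the
    parity. *)
Lemma odd_codeg_symdiff A B e :
  odd (codeg ((A :\: B) :|: (B :\: A)) e) = odd (codeg A e) (+) odd (codeg B e).
Proof.
pose X (C : {set {set T}}) := [set S in C | e \subset S].
have -> : codeg ((A :\: B) :|: (B :\: A)) e = #|X A :\: X B| + #|X B :\: X A|.
  rewrite -cardsUI (_ : (X A :\: X B) :&: _ = set0) ?cards0 ?addn0.
    apply: eq_card => S; rewrite !inE.
    by case: (S \in A); case: (S \in B); case: (e \subset S).
  by apply/setP=> S; rewrite !inE; case: (S \in A); case: (S \in B);
    case: (e \subset S).
rewrite /codeg -/(X A) -/(X B) -(cardsID (X B) (X A)) -(cardsID (X A) (X B)).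
rewrite [X B :&: _]setIC !oddD; do 3 case: odd => //.
Qed.

(** A member through xy makes the codegree of xy positive, hence, being even, at least 2. *)
Lemma core_of_even A :
  (forall S, S \in A -> #|S| = 3) ->
  (forall x y, x != y -> ~~ odd (codeg A [set x; y])) -> core A.
Proof.
move=> unif even x y z tx; have [/eqP xy xz yz] := tri_neq unif tx.
pose X := [set S in A | [set x; y] \subset S].
have SX : [set x; y; z] \in X by rewrite inE (tx : _ \in A) subsetUl.
have : 0 < #|X :\ [set x; y; z]|.
  move: (even _ _ xy); rewrite /codeg -/X (cardsD1 [set x; y; z] X) SX.
  by case: #|_|.
case/card_gt0P=> S'; rewrite !inE => /andP[ne /andP[S'A sub]].
have xS : x \in S' by apply: (subsetP sub); rewrite !inE eqxx.
have yS : y \in S' by apply: (subsetP sub); rewrite !inE eqxx orbT.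
have [u [v E]] := triP unif S'A xS; subst S'.
move: yS; rewrite !inE eq_sym (negPf xy) => /orP[] /eqP e; subst y.
  by exists v => // e; subst v; rewrite eqxx in ne.
by exists u; [move=> e; subst u; rewrite setUAC eqxx in ne | apply: tri_swap23].
Qed.

Lemma core_exists F V :
  (forall S, S \in F -> #|S| = 3) -> (forall S, S \in F -> S \subset V) ->
  'C(#|V|.-1, 2) < #|F| ->
  exists A, [/\ A \subset F, A != set0 & core A].
Proof.
move=> unif sub lt.
have /card_gt0P[S0 S0F] : 0 < #|F| by case: #|F| lt.
have /card_gt0P[v0 v0S] : 0 < #|S0| by rewrite unif.
have v0V : v0 \in V := subsetP (sub _ S0F) _ v0S.
pose P := [set e : {set T} | (e \subset V :\ v0) && (#|e| == 2)].
have cP : #|P| = 'C(#|V|.-1, 2) by rewrite cards_draws (cardsD1 v0 V) v0V.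
pose phi (A : {set {set T}}) := [set e in P | odd (codeg A e)].
have : ~~ dinjectiveb phi (powerset F).
  (* [F] has more subfamilies than there are parity vectors indexed by the pairs avoiding [v0]. *)
  apply/negP=> /dinjectiveP/card_in_imset c.
  have : #|phi @: powerset F| <= #|powerset P|.
    apply/subset_leq_card/subsetP=> _ /imsetP[A _ ->].
    by rewrite powersetE; apply/subsetP=> e; rewrite inE => /andP[].
  by rewrite c !card_powerset cP leq_exp2l // leqNgt lt.
case/dinjectivePn=> A1 A1F [A2]; rewrite inE /= => /andP[ne A2F] eqphi.
rewrite !powersetE in A1F A2F.
pose A := (A1 :\: A2) :|: (A2 :\: A1).
have AF : A \subset F.
  by rewrite subUset !(subset_trans (subsetDl _ _)).
have unifA S : S \in A -> #|S| = 3 by move/(subsetP AF)/unif.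
have evenP e : e \in P -> ~~ odd (codeg A e).
  move=> eP; rewrite odd_codeg_symdiff.
  by move/setP/(_ e): eqphi; rewrite ![e \in phi _]inE eP /= => ->; rewrite addbb.
exists A; split=> //.
  apply: contra ne => /eqP/setP A0; apply/eqP/setP=> S.
  by move: (A0 S); rewrite !inE; case: (S \in A1); case: (S \in A2).
apply: core_of_even => // x y xy.
have [|out] := boolP ([set x; y] \subset V); last first.
  rewrite /codeg (_ : [set S in A | _] = set0) ?cards0 //; apply/setP=> S; rewrite inE [RHS]inE.
  apply/andP=> -[SA eS]; case/negP: out; apply: subset_trans eS _.
  by apply: sub; apply: (subsetP AF).
rewrite subUset !sub1set => /andP[xV yV].
(* The codegrees of the pairs {z, u} sum to twice the degree of [z]; all terms but u = [v0] are even
   by [evenP], so that one is even too. *)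
have evenV0 z : z \in V -> z != v0 -> ~~ odd (codeg A [set z; v0]).
  move=> zV zv0.
  have : ~~ odd (\sum_(u in V :\ z) codeg A [set z; u]).
    under eq_bigr do rewrite codegE.
    rewrite exchange_big /=.
    rewrite (eq_bigr (fun S => (z \in S).*2)) => [|S SA]; last first.
      have [zS|zS] := boolP (z \in S); last first.
        by rewrite big1 // => u _; rewrite subUset sub1set (negPf zS).
      have -> : 1.*2 = #|S :\ z|.
        by move/eqP: (unifA _ SA); rewrite (cardsD1 z) zS eqSS => /eqP->.
      rewrite -sum1_card big_mkcond [RHS]big_mkcond /=; apply: eq_bigr => u _.
      rewrite subUset !sub1set zS !inE; case: (u == z) => //=.
      case uS: (u \in S) => //=; last by case: ifP.
      by rewrite (subsetP (sub _ (subsetP AF _ SA))).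
    by rewrite -(big_morph _ doubleD double0) odd_double.
  rewrite (bigD1 v0) /=; last by rewrite !inE eq_sym zv0.
  rewrite oddD [X in _ (+) X](_ : _ = false) ?addbF //.
  apply/negP; apply/negP; apply: (big_ind (fun k => ~~ odd k)) => // [a b|u].
    by rewrite oddD => /negPf-> /negPf->.
  rewrite !inE => /andP[/andP[uz uV] uv0]; apply: evenP.
  by rewrite inE subUset !sub1set !inE uV uv0 zV zv0 cards2 [z == u]eq_sym uz.
have [ex|xv0] := eqVneq x v0.
  by rewrite ex setUC evenV0 // -ex eq_sym.
have [->|yv0] := eqVneq y v0; first exact: evenV0.
by apply: evenP; rewrite inE subUset !sub1set !inE xv0 yv0 xV yV cards2 xy.
Qed.
End Cores.

(* Marks the hypotheses that tri_dist has already processed. *)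
Definition visited (P : Prop) (p : P) := True.

Ltac tri_dist unif := repeat match goal with H : is_true (tri _ ?x ?y ?z) |- _ =>
  lazymatch goal with _ : visited H |- _ => fail | _ =>
    have ? : visited H by []; case: (tri_neq unif H) => ? ? ? end end;
  repeat match goal with H : visited _ |- _ => clear H end.

(** Case analysis on equalities between points: contradictory equalities are discarded first, the
    remaining ones substituted. *)
Ltac split_eq := intros; repeat match goal with
  | H : ?x <> ?x |- _ => case: (H erefl)
  | H : ?x = ?x |- _ => clear H
  | H : ?x = ?x -> _ |- _ => specialize (H erefl)
  | H : _ /\ _ |- _ => destruct H
  | H : ?x = ?y, N : ?x <> ?y |- _ => case: (N H)
  | H : ?x = ?y, N : ?y <> ?x |- _ => case: (N (esym H))
  | H : ?x = ?y \/ _, N : ?x <> ?y |- _ => destruct H as [H|H]; [case: (N H)|]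
  | H : ?x = ?y \/ _, N : ?y <> ?x |- _ =>
    destruct H as [H|H]; [case: (N (esym H))|]
  end;
  first [ done | lazymatch goal with
  | H : ?x = ?y |- _ => first [subst x | subst y]; split_eq
  | H : _ \/ _ |- _ => destruct H; split_eq
  | |- _ => solve [congruence | tauto]
  end ].

Ltac solve_eq unif := tri_dist unif; split_eq.

(** * Configurations forced by cores *)

Section Configurations.
Variable T : finType.
Variable F : {set {set T}}.
Implicit Types (A : {set {set T}}) (S B V : {set T}).
Hypothesis unif : forall S, S \in F -> #|S| = 3.
Hypothesis uns : unshattered F.

Local Notation t := (tri F).
Local Notation T0 := (T0 F).
Local Notation T1 := (T1 F).
Local Notation T2 := (T2 F).

Lemma T0_swap12 a b c : T0 a b c -> T0 b a c.
Proof. by move=> h x y z /h; tauto. Qed.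

Lemma T0_swap23 a b c : T0 a b c -> T0 a c b.
Proof. by move=> h x y z /h; tauto. Qed.

Lemma T1_swap a b c : T1 a b c -> T1 a c b.
Proof. by move=> h x y /h; tauto. Qed.

(** Together with the member abc, [z] spans a complete K4. *)
Definition full a b c z := [/\ t a b z, t a c z & t b c z].

Definition two_full := exists a b c z z',
  [/\ T0 a b c, t a b c, z <> z', full a b c z & full a b c z'].

(** The pair zw is disjoint from abc and lies in the links of both [a] and [b]: it carries two of
    the colours a, b, c. *)
Definition two_coloured a b c z w :=
  [/\ T0 a b c, t a b c, t a z w /\ t b z w & z <> c /\ w <> c].

(** The three variants record how the reasons of azw and bzw combine up to symmetry: one is empty,
    both are the same point, or they are different points. *)
Definition coloured_T0 := exists a b c z w,
  two_coloured a b c z w /\ T0 a z w.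
Definition coloured_T1 := exists a b c z w,
  two_coloured a b c z w /\ (T1 z a w /\ T1 z b w).
Definition coloured_T1' := exists a b c z w,
  two_coloured a b c z w /\ [/\ T1 z a w, T1 w b z, t a b z & t a b w].

(** * What the extensions of pairs inside a core force *)

Section CoreTypes.
Variable A : {set {set T}}.
Hypothesis AF : A \subset F.
Hypothesis cA : core A.

Let tAF x y z : tri A x y z -> t x y z. Proof. exact: (subsetP AF). Qed.

Lemma core_nonown x y z : tri A x y z -> T2 x y z -> False.
Proof. by case/cA=> z' ne /tAF + h => /h. Qed.

Lemma core_reason x y z : tri A x y z ->
  T0 x y z \/ (T1 x y z \/ T1 y x z \/ T1 z x y).
Proof.
move=> h; have := reason unif uns (tAF h).
have := core_nonown h; have := core_nonown (tri_swap23 h).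
have := core_nonown (tri_rotl h); tauto.
Qed.

(** The core extends bz by a point other than [w], which must be [a] by the reason [z] of azw;
    likewise aw extends to [b]. *)
Lemma coloured_config_T1 a b z w : tri A a z w -> tri A b z w ->
  a <> b -> T1 z a w -> T1 w b z -> t a b z /\ t a b w.
Proof.
move=> Aa Ab ab ha hb; have ta := tAF Aa; have tb := tAF Ab; split.
  have [y ne /tAF ty] := cA Ab.
  have e : y = a by have := ha b y ltac:(perm3); solve_eq unif.
  by subst y; perm3.
have [y ne /tAF ty] := cA (tri_swap23 Aa).
have e : y = b by have := hb a y ltac:(perm3); solve_eq unif.
by subst y; perm3.
Qed.

Lemma coloured_config a b c z w : T0 a b c -> t a b c -> tri A a z w ->
  tri A b z w -> z <> c -> w <> c -> coloured_T0 \/ coloured_T1 \/ coloured_T1'.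
Proof.
move=> h0 tabc Aa Ab zc wc.
have ta := tAF Aa; have tb := tAF Ab.
have ab : a <> b by tri_dist unif.
have C1 : two_coloured a b c z w by [].
have C2 : two_coloured a b c w z.
  by split=> //; repeat split=> //; apply: tri_swap23.
have C3 : two_coloured b a c z w.
  by split=> //; [exact: T0_swap12 | exact: tri_swap12].
(* The member abc excludes [a] as a reason of azw and [b] as a reason of bzw, so only the empty
   reason, [z] and [w] remain. *)
have nTa : ~ T1 a z w by move=> h; have := h _ _ tabc; solve_eq unif.
have nTb : ~ T1 b z w by move=> h; have := h _ _ (tri_swap12 tabc); solve_eq unif.
case: (core_reason Aa) => [ra|ra]; first by left; exists a, b, c, z, w.
case: (core_reason Ab) => [rb|rb]; first by left; exists b, a, c, z, w.
right; case: ra => [//|[ra|ra]]; case: rb => [//|[rb|rb]].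
- by left; exists a, b, c, z, w.
- have [] := coloured_config_T1 Aa Ab ab ra rb.
  by right; exists a, b, c, z, w.
- have [] := coloured_config_T1 Ab Aa (nesym ab) rb ra.
  by right; exists b, a, c, z, w.
- by left; exists a, b, c, w, z.
Qed.

(** The core extends zw by a second point, which lies in abc because every member meets abc; so zw
    has a second colour. *)
Lemma outer_config a b c z w : T0 a b c -> t a b c -> tri A a z w ->
  z <> b -> z <> c -> w <> b -> w <> c ->
  coloured_T0 \/ coloured_T1 \/ coloured_T1'.
Proof.
move=> h0 tabc Aa zb zc wb wc; have ta := tAF Aa.
have [y ya Ay] := cA (tri_rotl Aa); have ty := tAF Ay.
have [e|e] : y = b \/ y = c by have := h0 _ _ _ ty; solve_eq unif.
  by subst y; apply: (coloured_config h0 tabc Aa) => //; exact: tri_rotr.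
subst y; apply: (coloured_config (T0_swap23 h0) (tri_swap23 tabc) Aa) => //.
exact: tri_rotr.
Qed.

(** If az or bz extends to a point outside abc, an outer configuration arises; otherwise acz and bcz
    are in the core. As the core omits abc, ab extends to a further point outside abc, and the same
    argument there gives a second full point. *)
Lemma inner_config a b c z : T0 a b c -> t a b c -> ~~ tri A a b c ->
  tri A a b z ->
  two_full \/ (coloured_T0 \/ coloured_T1 \/ coloured_T1').
Proof.
move=> h0 tabc nA Aabz; have tabz := tAF Aabz.
have zc : z <> c by move=> e; subst z; rewrite Aabz in nA.
have complete z' : tri A a b z' ->
    full a b c z' \/ (coloured_T0 \/ coloured_T1 \/ coloured_T1').
  move=> Az; have tz := tAF Az.
  have z'c : z' <> c by move=> e; subst z'; rewrite Az in nA.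
  have [y yb Ay] := cA (tri_swap23 Az); have ty := tAF Ay.
  have [y' ya Ay'] := cA (tri_rotl Az); have ty' := tAF Ay'.
  have [e|yc] := eqVneq y c; last first.
    right; apply: (outer_config h0 tabc Ay) => //; try exact/eqP.
    by move=> e; subst z'; solve_eq unif.
  have [e'|y'c] := eqVneq y' c; last first.
    right; apply: (outer_config (T0_swap12 h0) (tri_swap12 tabc) Ay') => //;
    try exact/eqP.
    by move=> e'; subst z'; solve_eq unif.
  by subst y y'; left; split; perm3.
have [z' zz' Az'] := cA Aabz.
case: (complete _ Aabz) => [fz|]; last tauto.
case: (complete _ Az') => [fz'|]; last tauto.
by left; exists a, b, c, z, z'; split=> // e; case: zz'.
Qed.

Definition config :=
  two_full \/ (coloured_T0 \/ coloured_T1 \/ coloured_T1').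

Lemma vertex_config a b c y z : T0 a b c -> t a b c -> ~~ tri A a b c ->
  tri A a y z -> config.
Proof.
move=> h0 tabc nA Aayz; have tayz := tAF Aayz.
have nA' : ~~ tri A a c b by apply: contra nA; exact: tri_swap23.
have [e|/eqP yb] := eqVneq y b; first by subst y; exact: (inner_config h0 tabc nA Aayz).
have [e|/eqP yc] := eqVneq y c.
  by subst y; exact: (inner_config (T0_swap23 h0) (tri_swap23 tabc) nA' Aayz).
have [e|/eqP zb] := eqVneq z b.
  by subst z; exact: (inner_config h0 tabc nA (tri_swap23 Aayz)).
have [e|/eqP zc] := eqVneq z c.
  by subst z; exact: (inner_config (T0_swap23 h0) (tri_swap23 tabc) nA' (tri_swap23 Aayz)).
by right; apply: (outer_config h0 tabc Aayz).
Qed.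

Lemma T0_config a b c : T0 a b c -> t a b c -> A != set0 -> ~~ tri A a b c ->
  config.
Proof.
move=> h0 tabc /set0Pn[S SA] nA.
have [x [y [z e]]] := triP0 unif (subsetP AF _ SA); subst S.
have nb : ~~ tri A b a c by apply: contra nA; exact: tri_swap12.
have nc : ~~ tri A c a b by apply: contra nA; exact: tri_rotl.
have hb := T0_swap12 h0; have hc := T0_swap12 (T0_swap23 h0).
have tb := tri_swap12 tabc; have tc := tri_rotr tabc.
have A1 : tri A x y z by []; have A2 := tri_swap12 A1; have A3 := tri_rotr A1.
case: (h0 _ _ _ (tAF A1)) => [|[]] [e|[e|e]]; subst;
  first [apply: (vertex_config h0); eassumption
        |apply: (vertex_config hb); eassumption
        |apply: (vertex_config hc); eassumption].
Qed.

(** The core extends ab to a new [x], then ax to a point other than [b]; the reason [a] of abc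
    forces that point to be [c]. *)
Lemma T1_extend a b c : tri A a b c -> T1 a b c ->
  exists2 x, x <> c & tri A a b x /\ tri A a c x.
Proof.
move=> Aabc h; have [x xc Ax] := cA Aabc.
exists x => //; split=> //; have [y yb Ay] := cA (tri_swap23 Ax).
have tx := tAF Ax; have ty := tAF Ay; have tabc := tAF Aabc.
have e : y = c by have := h _ _ ty; solve_eq unif.
by subst y; exact: tri_swap23.
Qed.

Hypothesis no_T0 : forall a b c, t a b c -> ~ T0 a b c.

Lemma no_T0_T1 a b c : tri A a b c -> T1 a b c \/ T1 b a c \/ T1 c a b.
Proof. by move=> h; case: (core_reason h) => // /(no_T0 (tAF h)). Qed.

Lemma no_T0_config : A != set0 -> exists a b c x,
  [/\ T1 a b c, x <> c, t a b c, t a b x & t a c x].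
Proof.
case/set0Pn=> S SA; have [a [b [c e]]] := triP0 unif (subsetP AF _ SA); subst S.
have main a' b' c' : tri A a' b' c' -> T1 a' b' c' -> exists a b c x,
    [/\ T1 a b c, x <> c, t a b c, t a b x & t a c x].
  move=> At h; have [x xc [? ?]] := T1_extend At h.
  by exists a', b', c', x; split=> //; exact: tAF.
case: (no_T0_T1 SA) => [|[]]; apply: main => //; [exact: tri_swap12 | exact: tri_rotr].
Qed.

(** If [a] is the reason of abc, the core contains abx and acx. Both having reason [a] is excluded
    by the hypothesis; any other reason forces an extension of bc, bx or cx by a point other than
    [a] to be bcx. *)
Lemma core_K4 :
  (forall a b c x, t a b c -> c <> x -> b <> x ->
     T1 a b c -> T1 a b x -> T1 a c x -> False) ->
  forall a b c, tri A a b c -> exists x, x <> a /\ x <> b /\ x <> c /\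
  [/\ tri A a b x, tri A a c x & tri A b c x].
Proof.
move=> link_triangle.
have main a b c : tri A a b c -> T1 a b c -> exists2 x, x <> c &
    [/\ tri A a b x, tri A a c x & tri A b c x].
  move=> Aabc h; have [x xc [Aabx Aacx]] := T1_extend Aabc h; exists x => //.
  split=> //; have tabx := tAF Aabx; have tacx := tAF Aacx; have tabc := tAF Aabc.
  have [y1 y1a Ay1] := cA (tri_rotl Aabc); have ty1 := tAF Ay1.
  have [y2 y2a Ay2] := cA (tri_rotl Aabx); have ty2 := tAF Ay2.
  have [y3 y3a Ay3] := cA (tri_rotl Aacx); have ty3 := tAF Ay3.
  case: (no_T0_T1 Aabx) => [h1|[h1|h1]].
  - case: (no_T0_T1 Aacx) => [h2|[h2|h2]].
    + by case: (link_triangle _ _ _ _ tabc _ _ h h1 h2) => //; tri_dist unif; congruence.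
    + suff <- : y1 = x by [].
      by have := h2 b y1 ltac:(perm3); solve_eq unif.
    + suff <- : y2 = c by exact: tri_swap23.
      by have := h2 b y2 ltac:(perm3); solve_eq unif.
  - suff <- : y1 = x by [].
    by have := h1 c y1 ltac:(perm3); solve_eq unif.
  - suff <- : y3 = b by exact: tri_rotr.
    by have := h1 c y3 ltac:(perm3); solve_eq unif.
move=> a b c At; have tabc := tAF At.
case: (no_T0_T1 At) => [h|[h|h]].
- have [x xc [A1 A2 A3]] := main _ _ _ At h; exists x.
  have := tAF A1; have := tAF A3 => t1 t2; tri_dist unif; repeat split=> //; congruence.
- have [x xc [A1 A2 A3]] := main _ _ _ (tri_swap12 At) h; exists x.
  have := tAF A1; have := tAF A3 => t1 t2; tri_dist unif.
  by repeat split=> //; first [congruence | exact: tri_swap12].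
- have [x xc [A1 A2 A3]] := main _ _ _ (tri_rotr At) h; exists x.
  have := tAF A1; have := tAF A3 => t1 t2; tri_dist unif.
  by repeat split=> //; first [congruence | exact: tri_swap12].
Qed.
End CoreTypes.
End Configurations.

(** * Families with large degrees *)

Section LargeDegrees.
Variable T : finType.
Variables (F : {set {set T}}) (V : {set T}).
Implicit Types (A : {set {set T}}) (S B : {set T}).
Hypothesis unif : forall S, S \in F -> #|S| = 3.
Hypothesis uns : unshattered F.
Hypothesis sub : forall S, S \in F -> S \subset V.
Hypothesis V8 : 8 <= #|V|.
Hypothesis deg : forall v, v \in V -> #|V|.-1 <= #|[set S in F | v \in S]|.

Local Notation t := (tri F).
Local Notation T0 := (T0 F).
Local Notation T1 := (T1 F).
Local Notation T2 := (T2 F).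

(** * Counting edges in the link of a point *)

Lemma tri_inV x y z : t x y z -> [/\ x \in V, y \in V & z \in V].
Proof.
by move/sub/subsetP=> h; split; apply: h; rewrite !inE eqxx ?orbT.
Qed.

(** The link of [v] has at least |V|-1 edges, but [k] takes at most |V|-2 values. This refutes links
    that are a star at [a] with missing edges traded for as many others. *)
Lemma link_not_cover v a (k : T -> {set T}) : v \in V -> a \in V -> a <> v ->
  exists x y, t v x y /\
    (forall u, u \in V -> u <> v -> u <> a -> [set v; x; y] <> k u).
Proof.
move=> vV aV /eqP av; pose W := V :\ v :\ a.
have : ~~ ([set S in F | v \in S] \subset k @: W).
  apply/negP=> /subset_leq_card le.
  have : #|V| = #|W|.+2 by rewrite (cardsD1 v) vV (cardsD1 a) !inE av aV.
  by have := leq_trans (leq_trans (deg vV) le) (leq_imset_card k W); lia.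
case/subsetPn=> S; rewrite inE => /andP[SF vS] Sk.
have [x [y e]] := triP unif SF vS; subst S; exists x, y; split=> //.
move=> u uV /eqP uv /eqP ua e; case/negP: Sk; rewrite e.
by apply: imset_f; rewrite !inE uv ua uV.
Qed.

(** Charge each [u] with vau if that is a member, otherwise with one member through vu. An uncharged
    member vxy avoids [a]; if vx were private to it, vax would not be a member and [x] would be
    charged with vxy. *)
Lemma link_not_star v a : v \in V -> a \in V -> a <> v ->
  exists x y, [/\ t v x y, x <> a, y <> a,
    exists2 y', y' <> y & t v x y' & exists2 x', x' <> x & t v x' y].
Proof.
move=> vV aV av.
pose k u := if [set v; a; u] \in F then [set v; a; u]
  else odflt set0 [pick S in F | (v \in S) && (u \in S)].
have [x [y [tv nk]]] := link_not_cover k vV aV av.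
have main x' y' : [set v; x'; y'] = [set v; x; y] ->
    [/\ x' <> a, y' <> a & exists2 y'', y'' <> y' & t v x' y''].
  move=> E; have tv' : t v x' y' by rewrite /tri E.
  have [vx vy xy] := tri_neq unif tv'; have [_ xV yV] := tri_inV tv'.
  have xa : x' <> a.
    move=> e; subst x'; apply: (nk y' yV) => //; try congruence.
    by rewrite /k -E ifT.
  have ya : y' <> a.
    move=> e; subst y'; apply: (nk x' xV) => //; try congruence.
    by rewrite /k -E setUAC ifT // setUAC.
  split=> //; pose own := [forall y'', tri F v x' y'' ==> (y'' == y')].
  have [/forallP o|] := boolP own; last first.
    by rewrite negb_forall => /existsP[u]; rewrite negb_imply => /andP[tu /eqP];
      exists u.
  case: (nk x' xV) => //; try congruence.
  rewrite -E /k ifF; last first.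
    apply/negP=> h; have /implyP/(_ (tri_swap23 h))/eqP := o a; congruence.
  case: pickP => [S /= /and3P[SF vS xS]|/(_ [set v; x'; y'])] /=; last first.
    by rewrite -[_ \in F]/(tri F v x' y') tv' !inE !eqxx ?orbT.
  have [p [q e]] := triP unif SF vS; subst S.
  move: xS; rewrite !inE => /orP[/orP[]|] /eqP e; first congruence; subst.
    by have /implyP/(_ SF)/eqP -> := o q.
  by have /implyP/(_ (tri_swap23 SF))/eqP -> := o p; rewrite setUAC.
have [xa ya [y' ? ?]] := main x y erefl.
have [_ _ [x' ? ?]] := main y x (setUAC _ _ _).
exists x, y; split=> //; [by exists y' | by exists x' => //; exact: tri_swap23].
Qed.

Fixpoint avoids (x y : T) (s : seq (T * T)) : Prop :=
  if s is (p, q) :: s' then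
    (x = p -> y <> q) /\ (x = q -> y <> p) /\ avoids x y s'
  else True.

(** The link of [v] has at least |V|-1, hence 7, edges, so six pairs cannot exhaust it. *)
Lemma link_big v (s : seq (T * T)) : v \in V -> size s <= 6 ->
  exists x y, t v x y /\ avoids x y s.
Proof.
move=> vV s6; pose X := [set [set v; e.1; e.2] | e in s].
have : ~~ ([set S in F | v \in S] \subset X).
  apply/negP=> /subset_leq_card le.
  have h : #|X| <= #|s| := leq_imset_card _ _.
  by have := leq_trans (leq_trans (deg vV) le) (leq_trans h (leq_trans (card_size s) s6)); lia.
case/subsetPn=> S; rewrite inE => /andP[SF vS] SX.
have [x [y e]] := triP unif SF vS; subst S; exists x, y; split=> //.
have : forall p q, (p, q) \in s -> (x = p -> y <> q) /\ (x = q -> y <> p).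
  move=> p q pq; split=> e1 e2; subst; case/negP: SX; apply/imsetP.
    by exists (p, q).
  by exists (p, q); rewrite //= setUAC.
elim: s {vV s6 X SX} => //= -[p q] s IH h.
have [? ?] := h p q (mem_head _ _); do 2 split=> //.
by apply: IH => p' q' h'; apply: h; rewrite inE h' orbT.
Qed.

Lemma other_vertex (s : seq T) : size s <= 7 ->
  exists u, u \in V /\ foldr (fun x P => u <> x /\ P) True s.
Proof.
move=> s7; have /subsetPn[u uV us] : ~~ (V \subset s).
  apply/negP=> /subset_leq_card h.
  by have := leq_trans h (leq_trans (card_size s) s7); lia.
exists u; split=> //; elim: s {s7} us => //= x s IH.
by rewrite inE negb_or => /andP[/eqP ux /IH].
Qed.

Lemma no_coloured_T1 : ~ coloured_T1 F.
Proof.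
case=> a [b [c [z [w [[h0 tabc [ta [tb [zc wc]]]] [h1 h2]]]]]].
have [_ zV _] := tri_inV ta.
(* Edges of the link of [z] meet abc, aw and bw, which leaves only these four pairs. *)
have [x [y [tz /= av]]] := @link_big z [:: (a, b); (a, w); (b, w); (c, w)] zV isT.
have := h0 _ _ _ tz; have := h1 _ _ tz; have := h2 _ _ tz; solve_eq unif.
Qed.

(** A link edge of [u] meets abc and azw, so it contains [a] or joins {b, c} to {z, w}.
    [link_not_star] gives an edge xy of the second kind whose ends have further edges; of all
    reasons of uxy only the pair xy survives, and bzw then excludes x = b. *)
Lemma T0_T0_private_edge a b c z w u : T0 a b c -> T0 a z w ->
  t a b c -> t a z w -> t b z w -> z <> c -> w <> c -> u \in V ->
  u <> a -> u <> b -> u <> c -> u <> z -> u <> w ->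
  (t c z u /\ T2 c z u) \/ (t c w u /\ T2 c w u).
Proof.
move=> h0 h1 tabc ta tb zc wc uV ua ub uc uz uw; tri_dist unif.
have [aV bV cV] := tri_inV tabc; have [_ zV wV] := tri_inV ta.
have [u' /= [u'V u'ne]] := @other_vertex [:: a; b; c; z; w; u] isT.
have out : forall x y, (x = b \/ x = c) -> (y = z \/ y = w) -> ~ T0 x y u.
  move=> x y ex ey h2.
  (* A link edge of [u'] meets abc, azw and xyu, which leaves six pairs; the last one joins [x] to
     the point of zw other than [y]. *)
  have [p [q [tu' /= av]]] := @link_big u' 
    [:: (a, x); (a, y); (a, u); (b, y); (c, y); (x, if y == z then w else z)] u'V isT.
  have := h0 _ _ _ tu'; have := h1 _ _ _ tu'; have := h2 _ _ _ tu'.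
  move: av; case: eqP; solve_eq unif.
suff main x y : t u x y -> (x = b \/ x = c) -> (y = z \/ y = w) ->
    (exists2 y', y' <> y & t u x y') -> (exists2 x', x' <> x & t u x' y) ->
    (t c z u /\ T2 c z u) \/ (t c w u /\ T2 c w u).
  have [x [y [tu xa ya nx ny]]] := link_not_star uV aV (nesym ua).
  have := h0 _ _ _ tu; have := h1 _ _ _ tu => e1 e2.
  have [[ex ey]|[ex ey]] : ((x = b \/ x = c) /\ (y = z \/ y = w)) \/
    ((y = b \/ y = c) /\ (x = z \/ x = w)) by split_eq.
    exact: main tu ex ey nx ny.
  apply: main (tri_swap23 tu) ex ey _ _.
    by case: ny => y' ? ?; exists y' => //; exact: tri_swap23.
  by case: nx => x' ? ?; exists x' => //; exact: tri_swap23.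
move=> tu ex ey [y' y'y ty'] [x' x'x tx'].
case: (reason unif uns (tri_rotl tu)) => [h|[[h|[h|h]]|[h|[h|h]]]].
- by case: (out _ _ ex ey h).
- case: ex => e; subst x; first by have := h _ _ (tri_swap12 tabc); split_eq.
  by have := h _ _ (tri_rotr tabc); split_eq.
- case: ey => e; subst y; first by have := h _ _ (tri_swap12 ta); split_eq.
  by have := h _ _ (tri_rotr ta); split_eq.
- have [p [q [tp /= av]]] := @link_big u
    [:: (a, x); (a, y); (x, z); (x, w); (b, y); (c, y)] uV isT.
  by have := h0 _ _ _ tp; have := h1 _ _ _ tp; have := h _ _ tp; solve_eq unif.
- have tuyx := tri_rotl tu.
  case: ex => e; subst x; last by case: ey => e; subst y; [left|right].
  case: ey => e; subst y; first by have := h _ tb; split_eq.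
  by have := h _ (tri_swap23 tb); split_eq.
- by have := h _ (tri_swap12 ty'); split_eq.
- by have := h _ (tri_rotr tx'); split_eq.
Qed.

(** There are three points outside a, b, c, z, w, each the third point of a private pair cz or cw;
    two of them would share that pair. *)
Lemma no_coloured_T0 : ~ coloured_T0 F.
Proof.
case=> a [b [c [z [w [[h0 tabc [ta [tb [zc wc]]]] h1]]]]].
have key u := T0_T0_private_edge (u := u) h0 h1 tabc ta tb zc wc.
have [u1 /= [u1V [? [? [? [? [? _]]]]]]] := @other_vertex [:: a; b; c; z; w] isT.
have [u2 /= [u2V [? [? [? [? [? [? _]]]]]]]] := @other_vertex [:: a; b; c; z; w; u1] isT.
have [u3 /= [u3V [? [? [? [? [? [? [? _]]]]]]]]] := @other_vertex [:: a; b; c; z; w; u1; u2] isT.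
case: (key u1) => // -[t1 p1]; case: (key u2) => // -[t2 p2];
  case: (key u3) => // -[t3 p3];
  first [by have := p1 _ t2; split_eq | by have := p1 _ t3; split_eq
        | by have := p2 _ t3; split_eq].
Qed.

(** * Two full points over a member with empty reason *)

Section TwoFull.

(** [star] and [isolated] are what the empty reason and the reason [z] of abz say about the link of
    [c]. *)
Let star a b c z := forall x y, t c x y ->
  (x = z \/ x = a \/ x = b) \/ (y = z \/ y = a \/ y = b).
Let isolated a b c z := forall y, t c z y -> y = a \/ y = b.

(** The member abc and the other triples of the two K4s refute every reason of abz except the empty
    one and [z]. *)
Let star_or_isolated a b c z z' : T0 a b c -> t a b c -> z <> z' ->
  full F a b c z -> full F a b c z' -> star a b c z \/ isolated a b c z.
Proof.
move=> h0 tabc zz' [abz acz bcz] [abz' acz' bcz']; tri_dist unif.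
case: (reason unif uns abz) => [h|[[h|[h|h]]|[h|[h|h]]]].
- by left=> x y tc; have := h _ _ _ tc; split_eq.
- by have := h _ _ acz'; split_eq.
- by have := h _ _ bcz'; split_eq.
- by right=> y tc; have := h _ _ (tri_swap12 tc); split_eq.
- by have := h _ tabc; split_eq.
- by have := h _ (tri_swap23 acz); split_eq.
- by have := h _ (tri_swap23 bcz); split_eq.
Qed.

Let full_swap12 a b c z : full F a b c z -> full F b a c z.
Proof. by case=> ? ? ?; split; perm3. Qed.

Let full_swap23 a b c z : full F a b c z -> full F a c b z.
Proof. by case=> ? ? ?; split; perm3. Qed.

(** All link edges of [z] contain [a], except bc. Without azz' there would be at most |V|-2 of them;
    with azz', the alternative for [z'] in the link of [a] leaves only four. *)
Let isolated2 a b c z z' : T0 a b c -> t a b c -> z <> z' ->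
  full F a b c z -> full F a b c z' ->
  isolated a b c z -> isolated a c b z -> False.
Proof.
move=> h0 tabc zz' fz fz' ic ib.
have sz : star b c a z \/ isolated b c a z.
  apply: (@star_or_isolated b c a z z') => //; try perm3.
  - exact/T0_swap23/T0_swap12.
  - exact/full_swap23/full_swap12.
  - exact/full_swap23/full_swap12.
have sz' : star b c a z' \/ isolated b c a z'.
  apply: (@star_or_isolated b c a z' z) => //; try perm3.
  - exact/T0_swap23/T0_swap12.
  - exact: nesym.
  - exact/full_swap23/full_swap12.
  - exact/full_swap23/full_swap12.
case: fz fz' => abz acz bcz [abz' acz' bcz']; tri_dist unif.
have [_ zV z'V] : [/\ a \in V, z \in V & z' \in V].
  by have [] := tri_inV abz; have [] := tri_inV abz'.
have aV : a \in V by have [] := tri_inV abz.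
have inner x y : t z x y -> x = a \/ y = a \/ (x = b /\ y = c) \/ (x = c /\ y = b).
  move=> tz; have := h0 _ _ _ tz; case=> [|[]] [e|[e|e]]; subst; try solve [tauto | split_eq].
  - by have := ib _ (tri_swap12 tz); split_eq.
  - by have := ic _ (tri_swap12 tz); split_eq.
  - by have := ib _ (tri_rotr tz); split_eq.
  - by have := ic _ (tri_rotr tz); split_eq.
have azz' : t a z z'.
  apply/negP=> /negP nt.
  pose k u := if u == z' then [set z; b; c] else [set z; a; u].
  have az : a <> z by [].
  have [x [y [tz nk]]] := link_not_cover k zV aV az.
  have slot u : t z a u -> [set z; x; y] <> [set z; a; u].
    move=> tu; have [_ _ uV] := tri_inV tu; tri_dist unif.
    have : [set z; x; y] <> k u by apply: nk; congruence.
    rewrite /k.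
    by case: eqP => // e; subst u; case/negP: nt; perm3.
  case: (inner _ _ tz) => [e|[e|[[e1 e2]|[e1 e2]]]]; subst.
  - by have := slot _ tz.
  - by have := slot _ (tri_swap23 tz); rewrite setUAC.
  - by apply: (nk z' z'V); [congruence | congruence | rewrite /k eqxx].
  - by apply: (nk z' z'V); [congruence | congruence | rewrite /k eqxx setUAC].
have [x [y [tz /= av]]] := @link_big z [:: (a, b); (a, c); (b, c); (a, z')] zV isT.
have only : forall y, t a z y -> y = z' \/ y = b \/ y = c.
  move=> u tu; case: sz' => [h|h].
    by have := h _ _ tu; solve_eq unif.
  by have := h _ (tri_swap23 azz'); split_eq.
case: (inner _ _ tz) => [e|[e|[[e1 e2]|[e1 e2]]]]; subst.
- by have := only _ (tri_swap12 tz); split_eq.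
- by have := only _ (tri_rotr tz); split_eq.
- by split_eq.
- by split_eq.
Qed.

(** By [isolated2], [z'] is in the [star] case for both [a] and [b]; so in the link of [z] these two
    points have no neighbours besides [z'] and points of abc, and five pairs remain. *)
Let isolated1 a b c z z' : T0 a b c -> t a b c -> z <> z' ->
  full F a b c z -> full F a b c z' ->
  isolated a b c z -> isolated a b c z' -> False.
Proof.
move=> h0 tabc zz' fz fz' iz iz'.
have zz'' := nesym zz'.
have [/T0_swap23 hb tb fbz fbz'] : [/\ T0 a b c, t a c b, full F a c b z & full F a c b z'].
  by split=> //; [exact: tri_swap23 | exact: full_swap23 | exact: full_swap23].
have [ha ta faz faz'] : [/\ T0 b c a, t b c a, full F b c a z & full F b c a z'].
  split; [exact/T0_swap23/T0_swap12 | exact: tri_rotl |..];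
    exact/full_swap23/full_swap12.
have iz_ : isolated b a c z by move=> y /iz; tauto.
have iz'_ : isolated b a c z' by move=> y /iz'; tauto.
have h0_ := T0_swap12 h0; have tbac := tri_swap12 tabc.
have fz_ := full_swap12 fz; have fz'_ := full_swap12 fz'.
have [sb|ib] := star_or_isolated hb tb zz' fbz fbz'; last first.
  exact: isolated2 h0 tabc zz' fz fz' iz ib.
have [sb'|ib] := star_or_isolated hb tb zz'' fbz' fbz; last first.
  exact: isolated2 h0 tabc zz'' fz' fz iz' ib.
have [sa|ia] := star_or_isolated ha ta zz' faz faz'; last first.
  exact: isolated2 h0_ tbac zz' fz_ fz'_ iz_ ia.
have [sa'|ia] := star_or_isolated ha ta zz'' faz' faz; last first.
  exact: isolated2 h0_ tbac zz'' fz'_ fz_ iz'_ ia.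
case: fz fz' => abz acz bcz [abz' acz' bcz'].
have [_ _ zV] := tri_inV abz.
have [x [y [tz /= av]]] :=
  @link_big z [:: (a, b); (a, c); (b, c); (a, z'); (b, z')] zV isT.
tri_dist unif.
case: (h0 _ _ _ tz) => [|[]] [e|[e|e]]; subst; try split_eq.
- by have := sa' _ _ (tri_swap12 tz); split_eq.
- by have := sb' _ _ (tri_swap12 tz); split_eq.
- by have := iz _ (tri_swap12 tz); split_eq.
- by have := sa' _ _ (tri_rotr tz); split_eq.
- by have := sb' _ _ (tri_rotr tz); split_eq.
- by have := iz _ (tri_rotr tz); split_eq.
Qed.

(** By [isolated1] one of [z], [z'] is in the [star] case; that one serves as [p]. *)
Let partner a b c z z' : T0 a b c -> t a b c -> z <> z' ->
  full F a b c z -> full F a b c z' ->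
  exists p, forall u y, t c u y -> u <> a -> u <> b -> u <> z -> u <> z' ->
    y = p \/ y = a \/ y = b.
Proof.
move=> h0 tabc zz' fz fz'.
have [s|i] := star_or_isolated h0 tabc zz' fz fz'.
  by exists z => u y tu *; have := s _ _ tu; split_eq.
have [s|i'] := star_or_isolated h0 tabc (nesym zz') fz' fz.
  by exists z' => u y tu *; have := s _ _ tu; split_eq.
by case: (isolated1 h0 tabc zz' fz fz' i i').
Qed.

(** In the link of a further point [u], each of a, b, c has at most one neighbour outside abc, so
    there are at most six edges. *)
Lemma no_two_full : ~ two_full F.
Proof.
case=> a [b [c [z [z' [h0 tabc zz' fz fz']]]]].
have [pc hc] := partner h0 tabc zz' fz fz'.
have [pb hb] := partner (T0_swap23 h0) (tri_swap23 tabc) zz'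
  (full_swap23 fz) (full_swap23 fz').
have [pa ha] := partner (T0_swap23 (T0_swap12 h0)) (tri_rotl tabc) zz'
  (full_swap23 (full_swap12 fz)) (full_swap23 (full_swap12 fz')).
have [u /= [uV une]] := @other_vertex [:: a; b; c; z; z'] isT.
have [x [y [tu /= av]]] := @link_big u
  [:: (a, b); (a, c); (b, c); (a, pa); (b, pb); (c, pc)] uV isT.
tri_dist unif; have := h0 _ _ _ tu; case=> [|[]] [e|[e|e]]; subst; try split_eq.
- by have := ha _ _ (tri_swap12 tu); split_eq.
- by have := hb _ _ (tri_swap12 tu); split_eq.
- by have := hc _ _ (tri_swap12 tu); split_eq.
- by have := ha _ _ (tri_rotr tu); split_eq.
- by have := hb _ _ (tri_rotr tu); split_eq.
- by have := hc _ _ (tri_rotr tu); split_eq.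
Qed.

End TwoFull.

(** * A two-coloured pair with two different point reasons *)

Section ColouredT1.

(** The data of [coloured_T1'], arranged to be symmetric under exchanging [a] with [b] and [z] with
    [w] simultaneously. *)
Let conf a b c z w :=
  (T0 a b c /\ T1 z a w /\ T1 w b z) /\
  (t a b c /\ t a z w /\ t b z w /\ t a b z /\ t a b w) /\ z <> c /\ w <> c.

Let conf_sym a b c z w : conf a b c z w -> conf b a c w z.
Proof.
case=> [[h0 [h1 h2]] [[t1 [t2 [t3 [t4 t5]]]] [n1 n2]]].
split; first by split; [exact: T0_swap12|].
by repeat split=> //; perm3.
Qed.

Let link_z a b c z w x y : conf a b c z w -> t z x y ->
  (x = a \/ y = a) \/ (x = b /\ y = w \/ x = w /\ y = b) \/
  (x = c /\ y = w \/ x = w /\ y = c).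
Proof.
case=> [[h0 [h1 h2]] [[t1 [t2 [t3 [t4 t5]]]] [n1 n2]]] tz.
have := h0 _ _ _ tz; have := h1 _ _ tz; tri_dist unif.
case=> -[e|e]; subst; try tauto; case=> [|[]] [e|[e|e]]; subst; tauto.
Qed.

(** Only bw and cw can avoid [a] in the link of [z], so two missing edges at [a] would leave at most
    |V|-2 edges; [k] trades the missing ones for bw and cw. *)
Let missing_unique a b c z w u0 u1 : conf a b c z w -> u0 \in V -> u1 \in V ->
  u0 <> u1 -> u0 <> z -> u0 <> a -> u1 <> z -> u1 <> a ->
  t a z u0 \/ t a z u1.
Proof.
move=> cf u0V u1V ne nz0 na0 nz1 na1.
have [//|n0] := boolP (t a z u0); first by left.
have [//|n1] := boolP (t a z u1); first by right.
have [_ [[_ [taz _]] _]] := cf; have [aV zV _] := tri_inV taz; tri_dist unif.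
pose k u := if u == u0 then [set z; b; w] else
  if u == u1 then [set z; c; w] else [set z; a; u].
have az : a <> z by [].
have [x [y [tz nk]]] := link_not_cover k zV aV az.
have slot u : t z a u -> [set z; x; y] <> [set z; a; u].
  move=> tu; have [_ _ uV] := tri_inV tu; tri_dist unif.
  have : [set z; x; y] <> k u by apply: nk; congruence.
  rewrite /k; case: eqP => [e|_]; first by subst u; case/negP: n0; perm3.
  by case: eqP => // e; subst u; case/negP: n1; perm3.
case: (link_z cf tz) => [[e|e]|[[[e1 e2]|[e1 e2]]|[[e1 e2]|[e1 e2]]]]; subst.
- by case: (slot _ tz).
- by case: (slot _ (tri_swap23 tz)); rewrite setUAC.
- by case: (nk u0) => //; rewrite /k eqxx.
- by case: (nk u0) => //; rewrite /k eqxx setUAC.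
- by case: (nk u1) => //; rewrite /k eqxx ifF //; apply/eqP; congruence.
- by case: (nk u1) => //; rewrite /k eqxx setUAC ifF //; apply/eqP; congruence.
Qed.

(** Without czw only bw avoids [a], so not even one edge at [a] can be missing. *)
Let missing_none a b c z w u0 : conf a b c z w -> ~ t c z w -> u0 \in V ->
  u0 <> z -> u0 <> a -> t a z u0.
Proof.
move=> cf ncw u0V nz0 na0.
have [//|n0] := boolP (t a z u0).
have [_ [[_ [taz _]] _]] := cf; have [aV zV _] := tri_inV taz; tri_dist unif.
pose k u := if u == u0 then [set z; b; w] else [set z; a; u].
have az : a <> z by [].
have [x [y [tz nk]]] := link_not_cover k zV aV az.
have slot u : t z a u -> [set z; x; y] <> [set z; a; u].
  move=> tu; have [_ _ uV] := tri_inV tu; tri_dist unif.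
  have : [set z; x; y] <> k u by apply: nk; congruence.
  by rewrite /k; case: eqP => // e; subst u; case/negP: n0; perm3.
case: (link_z cf tz) => [[e|e]|[[[e1 e2]|[e1 e2]]|[[e1 e2]|[e1 e2]]]]; subst.
- by case: (slot _ tz).
- by case: (slot _ (tri_swap23 tz)); rewrite setUAC.
- by case: (nk u0) => //; rewrite /k eqxx.
- by case: (nk u0) => //; rewrite /k eqxx setUAC.
- by case: ncw; perm3.
- by case: ncw; perm3.
Qed.

Let outer a b c z w u :=
  u \in V /\ u <> a /\ u <> b /\ u <> c /\ u <> z /\ u <> w.

Let outer_sym a b c z w u : outer a b c z w u -> outer b a c w z u.
Proof. by rewrite /outer; tauto. Qed.

Let other_outer a b c z w u1 u2 :
  exists u, u <> u1 /\ u <> u2 /\ outer a b c z w u.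
Proof.
have [u /= [uV ?]] := @other_vertex [:: a; b; c; z; w; u1; u2] isT.
by exists u; rewrite /outer; tauto.
Qed.

Let some_azu a b c z w : conf a b c z w ->
  exists2 u, outer a b c z w u & t a z u.
Proof.
move=> cf; have [u1 [_ [_ o1]]] := other_outer a b c z w a a.
have [u2 [ne [_ o2]]] := other_outer a b c z w u1 u1.
case: (o1) => [V1 [? [? [? [? ?]]]]]; case: (o2) => [V2 [? [? [? [? ?]]]]].
have [h|h] : t a z u1 \/ t a z u2 by apply: (missing_unique cf) => //; exact: nesym.
- by exists u1.
- by exists u2.
Qed.

(** Only the empty reason and [a] survive for abz. If it is empty, a link edge of [c] avoiding [a]
    and [b] contains [z], and the reason [z] of azw makes it zw. *)
Let link_c a b c z w : conf a b c z w -> t c z w ->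
  (forall x y, t c x y -> (x = a \/ x = b) \/ (y = a \/ y = b) \/
     (x = z /\ y = w) \/ (x = w /\ y = z)) \/ T1 a b z.
Proof.
move=> cf tczw; have [u [uV uo] tbwu] := some_azu (conf_sym cf).
case: (cf) => [[h0 [h1 h2]] [[t1 [t2 [t3 [t4 t5]]]] [n1 n2]]]; tri_dist unif.
case: (reason unif uns t4) => [h|[[h|[h|h]]|[h|[h|h]]]].
- left=> x y tc; have := h _ _ _ tc; tri_dist unif.
  case=> [|[]] [e|[e|e]]; subst; try solve [tauto | split_eq].
    by have := h1 _ _ (tri_swap12 tc); split_eq; tauto.
  by have := h1 _ _ (tri_rotr tc); split_eq; tauto.
- by right.
- by have := h _ _ tbwu; split_eq.
- by have := h _ _ (tri_swap12 tczw); split_eq.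
- by have := h _ t1; split_eq.
- by have := h _ t2; split_eq.
- by have := h _ t3; split_eq.
Qed.

(** At an outer [u], take a link edge avoiding [a] whose ends have further edges. It contains [b] or
    [c]. With [b], its other end is [w]; with [c], its other end is none of a, b, z, w. Either way
    the further edge at that end violates a reason. *)
Let no_T1_T1 a b c z w : conf a b c z w -> T1 a b z -> T1 b a w -> False.
Proof.
move=> cf ha hb; have [u [_ [_ uo]]] := other_outer a b c z w a a.
case: (cf) => [[h0 [h1 h2]] [[t1 [t2 [t3 [t4 t5]]]] [n1 n2]]]; tri_dist unif.
have [aV _ _] := tri_inV t1; have [uV [ua [ub [uc [uz uw]]]]] := uo.
suff main x y : t u x y -> y <> a -> (x = b \/ x = c) ->
    (exists2 x', x' <> x & t u x' y) -> False.
  have [x [y [tu xa ya [y' y'y ty'] nx]]] := link_not_star uV aV (nesym ua).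
  have [ex|ey] : (x = b \/ x = c) \/ (y = b \/ y = c).
      by have := h0 _ _ _ tu; split_eq; tauto.
    exact: main tu ya ex nx.
  by apply: main (tri_swap23 tu) xa ey _; exists y' => //; exact: tri_swap23.
move=> tu ya ex [x' x'x tx'].
case: ex => e; subst x.
  have e : y = w by have := hb _ _ (tri_swap12 tu); split_eq.
  subst y; have := h0 _ _ _ tx'; have := h2 _ _ (tri_rotr tx'); split_eq.
have [yz yw] : y <> z /\ y <> w.
  split=> e; subst y.
    by have := h1 _ _ (tri_rotr tu); split_eq.
  by have := h2 _ _ (tri_rotr tu); split_eq.
have yb : y <> b.
  by move=> e; subst y; have := hb _ _ (tri_rotr tu); split_eq.
tri_dist unif; have := h0 _ _ _ tx'; case=> [|[]] [e|[e|e]]; subst; try split_eq.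
- by have := ha _ _ (tri_swap12 tx'); split_eq.
- by have := hb _ _ (tri_swap12 tx'); split_eq.
Qed.

(** Every reason of acz but [c] is refuted by a member. With reason [c], all link edges of [c]
    except zw contain [a], and aw is absent by the reason [w] of bzw; this makes at most |V|-2
    edges. *)
Let no_acz a b c z w : conf a b c z w -> t c z w ->
  (forall x y, t c x y -> (x = a \/ x = b) \/ (y = a \/ y = b) \/
     (x = z /\ y = w) \/ (x = w /\ y = z)) -> ~ t a c z.
Proof.
move=> cf tczw G tacz; have [u [uV uo] tbwu] := some_azu (conf_sym cf).
case: (cf) => [[h0 [h1 h2]] [[t1 [t2 [t3 [t4 t5]]]] [n1 n2]]]; tri_dist unif.
case: (reason unif uns tacz) => [h|[[h|[h|h]]|[h|[h|h]]]].
- by have := h _ _ _ tbwu; split_eq.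
- by have := h _ _ t5; split_eq.
- have [aV _ cV] := tri_inV t1; have [_ _ wV] := tri_inV t5.
  pose k u := if u == w then [set c; z; w] else [set c; a; u].
  have ac : a <> c by [].
  have [x [y [tc nk]]] := link_not_cover k cV aV ac.
  have slot u' : t c a u' -> [set c; x; y] <> [set c; a; u'].
    move=> tu; have [_ _ uV'] := tri_inV tu; tri_dist unif.
    have : [set c; x; y] <> k u' by apply: nk; congruence.
    rewrite /k; case: eqP => // e; subst u'.
    by have := h2 _ _ (tri_rotr tu); split_eq.
  have kw : [set c; x; y] <> [set c; z; w].
    by have := nk w wV; rewrite /k eqxx; apply; congruence.
  have [e|[e|[[e1 e2]|[e1 e2]]]] : x = a \/ y = a \/ (x = z /\ y = w) \/ (x = w /\ y = z).
  + have := h _ _ tc; have := G _ _ tc; tri_dist unif.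
    have nbz : ~ t c b z.
      by move=> tt; have := h1 _ _ (tri_rotr tt); split_eq.
    have nzb : ~ t c z b.
      by move=> tt; have := h1 _ _ (tri_swap12 tt); split_eq.
    split_eq; try tauto.
  + by subst x; case: (slot _ tc).
  + by subst y; case: (slot _ (tri_swap23 tc)); rewrite setUAC.
  + by subst x y; case: kw.
  + by subst x y; case: kw; rewrite setUAC.
- by have := h _ _ (tri_rotl t3); split_eq.
- by have := h _ (tri_swap23 t1); split_eq.
- by have := h _ t2; split_eq.
- by have := h _ tczw; split_eq.
Qed.

Let link_c_and_acz a b c z w : conf a b c z w ->
  (t c z w /\ ~ t a c z) \/ (~ t c z w /\ t a c z).
Proof.
move=> cf; have cf' := conf_sym cf.
case: (cf) => [[h0 [h1 h2]] [[t1 [t2 [t3 [t4 t5]]]] [n1 n2]]].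
have [tczw|/negP n] := boolP (t c z w); last first.
  right; split=> //; apply: tri_swap23; apply: (missing_none cf n).
  - by case: (tri_inV t1).
  - exact: nesym.
  - by tri_dist unif; congruence.
left; split=> //; apply: (no_acz cf tczw).
case: (link_c cf tczw) => // ha; case: (link_c cf' (tri_swap23 tczw)) => [h|hb].
  by move=> x y /h; tauto.
by case: (no_T1_T1 cf ha hb).
Qed.

(** If czw is a member, acz is the one missing edge that [missing_unique] allows; otherwise no edge
    is missing. *)
Let all_azu a b c z w u : conf a b c z w -> outer a b c z w u -> t a z u.
Proof.
move=> cf [uV [ua [ub [uc [uz uw]]]]].
have [[tczw nacz]|[n _]] := link_c_and_acz cf; last exact: (missing_none cf).
case: (cf) => [_ [[t1 [t2 [t3 [t4 t5]]]] [n1 n2]]].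
have [aV bV cV] := tri_inV t1.
have [h|//] : t a z c \/ t a z u.
  by apply: (missing_unique cf) => //; tri_dist unif; congruence.
by case: nacz; perm3.
Qed.

(** The member abc and the members through az or bw at outer points refute every other reason of
    auu'. *)
Let private_auu' a b c z w u u' : conf a b c z w -> outer a b c z w u ->
  outer a b c z w u' -> t a u u' -> T2 u u' a.
Proof.
move=> cf o o' tauu'.
have [u'' [u''u [u''u' o'']]] := other_outer a b c z w u u'.
have tazu := all_azu cf o; have tazu' := all_azu cf o'.
have tbwu := all_azu (conf_sym cf) (outer_sym o).
have tbwu' := all_azu (conf_sym cf) (outer_sym o').
have tbwu'' := all_azu (conf_sym cf) (outer_sym o'').
case: (cf) => [[h0 [h1 h2]] [[t1 [t2 [t3 [t4 t5]]]] [n1 n2]]].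
rewrite /outer in o o' o''; tri_dist unif.
case: (reason unif uns tauu') => [h|[[h|[h|h]]|[h|[h|h]]]].
- by have := h _ _ _ tbwu''; split_eq.
- by have := h _ _ t1; split_eq.
- by have := h _ _ (tri_rotr tbwu); split_eq.
- by have := h _ _ (tri_rotr tbwu'); split_eq.
- by have := h _ (tri_swap23 tazu); split_eq.
- by have := h _ (tri_swap23 tazu'); split_eq.
- by [].
Qed.

(** All reasons of acu are refuted; for the reason [c] this takes czw or bcw, one of which is a
    member by [link_c_and_acz]. *)
Let not_full_outer a b c z w u : conf a b c z w -> outer a b c z w u ->
  t a b u -> t a c u -> t b c u -> False.
Proof.
move=> cf o tabu tacu tbcu.
have [u' [u'u [_ o']]] := other_outer a b c z w u u.
have tbwu := all_azu (conf_sym cf) (outer_sym o).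
have tbwu' := all_azu (conf_sym cf) (outer_sym o').
have c_edge : t c z w \/ t b c w.
  have [[? _]|[n _]] := link_c_and_acz (conf_sym cf); first by left; perm3.
  have [[? _]|[_ ?]] := link_c_and_acz cf; first by left; perm3.
  right; have [[h _]|[_ //]] := link_c_and_acz (conf_sym cf).
  by case: n.
case: (cf) => [[h0 [h1 h2]] [[t1 [t2 [t3 [t4 t5]]]] [n1 n2]]].
rewrite /outer in o o'; tri_dist unif.
case: (reason unif uns tacu) => [h|[[h|[h|h]]|[h|[h|h]]]].
- by have := h _ _ _ tbwu'; split_eq.
- by have := h _ _ t4; split_eq.
- by case: c_edge => te; [have := h _ _ te | have := h _ _ (tri_swap12 te)]; split_eq.
- by have := h _ _ (tri_rotr tbwu); split_eq.
- by have := h _ (tri_swap23 t1); split_eq.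
- by have := h _ (tri_swap23 tabu); split_eq.
- by have := h _ (tri_rotl tbcu); split_eq.
Qed.

(** For each [s] in abc, [link_not_star] gives a link edge of an outer [u] that avoids [s]; its ends
    lie in abc. So abu, acu and bcu are members, against [not_full_outer]. *)
Lemma no_coloured_T1' : ~ coloured_T1' F.
Proof.
case=> a [b [c [z [w [[h0 tabc [ta [tb [zc wc]]]] [h1 h2 tabz tabw]]]]]].
have cf : conf a b c z w by rewrite /conf; do ?split.
have [u [_ [_ o]]] := other_outer a b c z w a a.
have main s : (s = a \/ s = b \/ s = c) -> exists x y,
    [/\ t u x y, x <> s, y <> s, (x = a \/ x = b \/ x = c) &
      (y = a \/ y = b \/ y = c)].
  move=> es; have [aV bV cV] := tri_inV tabc.
  have [uV uo] := o; have sV : s \in V by case: es => [|[]] ->.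
  have su : s <> u by split_eq.
  have [x [y [tu xs ys [y' y'y ty'] [x' x'x tx']]]] := link_not_star uV sV su.
  (* An end with two edges lies in abc: [z] can only be joined to [a], and [w] only to [b]; for an
     outer end, an edge to [a] or [b] is its only edge, so both edges would go to [c]. *)
  suff inner x1 y1 x2 : t u x1 y1 -> t u x2 y1 -> x1 <> x2 ->
      y1 = a \/ y1 = b \/ y1 = c.
    exists x, y; split=> //.
      by apply: (inner y x y'); [exact: tri_swap23 | exact: tri_swap23 | exact: nesym].
    by apply: (inner x y x') => //; exact: nesym.
  move=> tx1 tx2 ne.
  have [->|/eqP ya] := eqVneq y1 a; first by left.
  have [->|/eqP yb] := eqVneq y1 b; first by right; left.
  have [->|/eqP yc] := eqVneq y1 c; first by right; right.
  have [e|/eqP yz] := eqVneq y1 z.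
    subst y1; have := h1 _ _ (tri_rotr tx1); have := h1 _ _ (tri_rotr tx2).
    have := h0 _ _ _ tx1; have := h0 _ _ _ tx2; tri_dist unif; split_eq.
  have [e|/eqP yw] := eqVneq y1 w.
    subst y1; have := h2 _ _ (tri_rotr tx1); have := h2 _ _ (tri_rotr tx2).
    have := h0 _ _ _ tx1; have := h0 _ _ _ tx2; tri_dist unif; split_eq.
  have o1 : outer a b c z w y1 by have [_ _ ?] := tri_inV tx1.
  have cf' := conf_sym cf; have o' := outer_sym o; have o1' := outer_sym o1.
  have m1 := h0 _ _ _ tx1; have m2 := h0 _ _ _ tx2.
  tri_dist unif.
  have pa : t a u y1 -> x1 = a /\ x2 = a.
    move=> tt; have p := private_auu' cf o o1 tt.
    by split; apply: p; perm3.
  have pb : t b u y1 -> x1 = b /\ x2 = b.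
    move=> tt; have p := private_auu' cf' o' o1' tt.
    by split; apply: p; perm3.
  have [e1|[e1|e1]] : x1 = a \/ x1 = b \/ x1 = c by split_eq; tauto.
  - by subst x1; case: (pa (tri_swap12 tx1)); congruence.
  - by subst x1; case: (pb (tri_swap12 tx1)); congruence.
  have [e2|[e2|e2]] : x2 = a \/ x2 = b \/ x2 = c by split_eq; tauto.
  - by subst x2; case: (pa (tri_swap12 tx2)); congruence.
  - by subst x2; case: (pb (tri_swap12 tx2)); congruence.
  by congruence.
apply: (not_full_outer cf o).
- have [x [y [tu ? ? ? ?]]] := main c ltac:(tauto); tri_dist unif.
  have [[ex ey]|[ex ey]] : (x = a /\ y = b) \/ (x = b /\ y = a) by split_eq.
    by subst x y; perm3.
  by subst x y; perm3.
- have [x [y [tu ? ? ? ?]]] := main b ltac:(tauto); tri_dist unif.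
  have [[ex ey]|[ex ey]] : (x = a /\ y = c) \/ (x = c /\ y = a) by split_eq.
    by subst x y; perm3.
  by subst x y; perm3.
- have [x [y [tu ? ? ? ?]]] := main a ltac:(tauto); tri_dist unif.
  have [[ex ey]|[ex ey]] : (x = b /\ y = c) \/ (x = c /\ y = b) by split_eq.
    by subst x y; perm3.
  by subst x y; perm3.
Qed.

End ColouredT1.

(** * Complete K4s when no reason is empty *)

Section K4s.
Hypothesis no_T0 : forall a b c, t a b c -> ~ T0 a b c.

Definition assigned (Q : {set T}) v := exists b c,
  [/\ b \in Q, c \in Q, v <> b /\ v <> c /\ b <> c & T1 v b c].

(** A link edge of [a] covers all three sides of the triangle b, c, x, hence is one of them; three
    edges are too few. *)
Lemma link_triangle a b c x : t a b c -> c <> x -> b <> x ->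
  T1 a b c -> T1 a b x -> T1 a c x -> False.
Proof.
move=> tabc cx bx h1 h2 h3; have [aV _ _] := tri_inV tabc.
have [p [q [tp /= av]]] := @link_big a [:: (b, c); (b, x); (c, x)] aV isT.
have := h1 _ _ tp; have := h2 _ _ tp; have := h3 _ _ tp; solve_eq unif.
Qed.

Lemma isK4_fourth Q v b c : isK4 F Q -> v \in Q -> b \in Q -> c \in Q ->
  v <> b -> v <> c -> b <> c ->
  exists x, Q = [set v; b; c; x] /\ (x \in Q /\ x <> v /\ x <> b /\ x <> c).
Proof.
move=> [Q4 _] vQ bQ cQ /eqP vb /eqP vc /eqP bc.
have : #|Q :\ v :\ b :\ c| = 1.
  move: Q4; rewrite (cardsD1 v) vQ (cardsD1 b) !inE bQ eq_sym vb.
  by rewrite (cardsD1 c) !inE cQ ![c == _]eq_sym vc bc => -[].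
case/eqP/cards1P=> x e; have : x \in Q :\ v :\ b :\ c by rewrite e set11.
rewrite !inE => /and4P[/eqP xc /eqP xb /eqP xv xQ]; exists x; split=> //.
apply/setP=> u; move/setP/(_ u): e; rewrite !inE.
have [->|_] := eqVneq u v; first by rewrite vQ.
have [->|_] := eqVneq u b; first by rewrite bQ.
by have [->|_] := eqVneq u c; rewrite ?cQ.
Qed.

Lemma isK4_split Q v : isK4 F Q -> v \in Q -> exists b c x,
  Q = [set v; b; c; x] /\ (b \in Q /\ c \in Q /\ x \in Q) /\
  (v <> b /\ v <> c /\ v <> x /\ b <> c /\ b <> x /\ c <> x).
Proof.
move=> kQ vQ; have [Q4 _] := kQ.
have [|b] := @set0Pn _ (Q :\ v) _.
  by rewrite -card_gt0; move: Q4; rewrite (cardsD1 v) vQ; lia.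
rewrite !inE => /andP[/eqP bv bQ].
have [|c] := @set0Pn _ (Q :\ v :\ b) _.
  rewrite -card_gt0; move: Q4; rewrite (cardsD1 v) vQ (cardsD1 b) !inE bQ.
  by move/eqP: bv => ->; lia.
rewrite !inE => /and3P[/eqP cb /eqP cv cQ].
have [x [e [xQ [? [? ?]]]]] := isK4_fourth kQ vQ bQ cQ (nesym bv) (nesym cv) (nesym cb).
by exists b, c, x; do !split=> //; apply: nesym.
Qed.

(** Each pair of points of a K4 lies in two of its triples, so only point reasons are left. *)
Lemma isK4_T1 Q x y z : isK4 F Q -> x \in Q -> y \in Q -> z \in Q ->
  x <> y -> x <> z -> y <> z -> T1 x y z \/ T1 y x z \/ T1 z x y.
Proof.
move=> kQ xQ yQ zQ xy xz yz; have [_ tQ] := kQ.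
have [w [_ [wQ [wx [wy wz]]]]] := isK4_fourth kQ xQ yQ zQ xy xz yz.
have txyz : t x y z by exact: tQ.
have txyw : t x y w by apply: tQ => //; exact: nesym.
have txzw : t x z w by apply: tQ => //; exact: nesym.
have tyzw : t y z w by apply: tQ => //; exact: nesym.
case: (reason unif uns txyz) => [/(no_T0 txyz)//|[//|[h|[h|h]]]].
- by have := h _ txyw; split_eq.
- by have := h _ txzw; split_eq.
- by have := h _ tyzw; split_eq.
Qed.

(** If the fourth points [x] and [y] differed, the triples of [Q'] through [y] would leave [x] as
    the reason of abx, acx and bcx, against [link_triangle]. *)
Lemma isK4_share Q Q' a b c : isK4 F Q -> isK4 F Q' -> a <> b -> a <> c -> b <> c ->
  a \in Q -> b \in Q -> c \in Q -> a \in Q' -> b \in Q' -> c \in Q' -> Q = Q'.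
Proof.
move=> kQ kQ' ab ac bc aQ bQ cQ aQ' bQ' cQ'; have [_ tQ] := kQ; have [_ tQ'] := kQ'.
have [x [eQ [xQ [xa [xb xc]]]]] := isK4_fourth kQ aQ bQ cQ ab ac bc.
have [y [eQ' [yQ [ya [yb yc]]]]] := isK4_fourth kQ' aQ' bQ' cQ' ab ac bc.
have [e|/eqP xy] := eqVneq x y; first by rewrite eQ eQ' e.
have sub1 p q r : p \in Q -> q \in Q -> r \in Q -> q \in Q' -> p \in Q' -> r \in Q' ->
    p <> q -> p <> r -> q <> r -> x <> p -> x <> q -> x <> r ->
    y <> p -> y <> q -> y <> r -> T1 x p q.
  move=> *; have [h|[h|//]] : T1 p q x \/ T1 q p x \/ T1 x p q.
    by apply: (isK4_T1 kQ) => //; exact: nesym.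
  - have /h : t p r y by apply: tQ' => //; exact: nesym.
    by split_eq.
  - have /h : t q r y by apply: tQ' => //; exact: nesym.
    by split_eq.
case: (@link_triangle x a b c); try exact: nesym; try by [].
- by apply: tQ.
- by apply: (sub1 a b c).
- by apply: (sub1 a c b) => //; exact: nesym.
- by apply: (sub1 b c a) => //; exact: nesym.
Qed.

(** The pair bc covers the triangle that [Q'] forms in the link of [v], so [b] and [c] belong to it
    and the K4s share three points. *)
Lemma assigned_meet Q Q' v : isK4 F Q -> isK4 F Q' -> assigned Q v -> v \in Q ->
  v \in Q' -> Q = Q'.
Proof.
move=> kQ kQ' [b [c [bQ cQ [vb [vc bc]] h]]] vQ vQ'; have [_ tQ'] := kQ'.
have [d [e [f [eQ' [[dQ [eQ fQ]] [vd [ve [vf [de [df ef]]]]]]]]]] := isK4_split kQ' vQ'.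
have h1 := h _ _ (tQ' _ _ _ vQ' dQ eQ vd ve de).
have h2 := h _ _ (tQ' _ _ _ vQ' dQ fQ vd vf df).
have h3 := h _ _ (tQ' _ _ _ vQ' eQ fQ ve vf ef).
have bQ' : b \in Q'.
  have : b = d \/ b = e \/ b = f by clear -h1 h2 h3 de df ef; split_eq.
  by case=> [|[]] ->.
have cQ' : c \in Q'.
  have : c = d \/ c = e \/ c = f by clear -h1 h2 h3 de df ef; split_eq.
  by case=> [|[]] ->.
exact: (isK4_share kQ kQ' vb vc bc).
Qed.

(** Link edges of [v] contain [b] or are cx, so by the degree bound every vbz is a member. In a
    triple of [Q'] avoiding [b], no point [d] can then be the reason: vbd misses the other two. *)
Lemma no_double Q Q' v b c x : isK4 F Q -> isK4 F Q' -> Q <> Q' ->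
  v \in Q -> b \in Q -> c \in Q -> x \in Q ->
  v <> b -> v <> c -> v <> x -> b <> c -> b <> x -> c <> x ->
  T1 v b c -> T1 v b x -> False.
Proof.
move=> kQ kQ' QQ' vQ bQ cQ xQ vb vc vx bc bx cx h1 h2.
have [_ tQ] := kQ; have [_ tQ'] := kQ'.
have [vV bV _] := tri_inV (tQ _ _ _ vQ bQ cQ vb vc bc).
have tvbz z : z \in V -> z <> v -> z <> b -> t v b z.
  move=> zV zv zb; have [//|n] := boolP (t v b z).
  pose k u := if u == z then [set v; c; x] else [set v; b; u].
  have [p [q [tp nk]]] := link_not_cover k vV bV (nesym vb).
  have slot u : t v b u -> [set v; p; q] <> [set v; b; u].
    move=> tu; have [_ _ uV] := tri_inV tu; tri_dist unif.
    have : [set v; p; q] <> k u by apply: nk; congruence.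
    by rewrite /k; case: eqP => // e; subst u; rewrite tu in n.
  have kz : [set v; p; q] <> [set v; c; x].
    by have := nk z zV zv zb; rewrite /k eqxx.
  have [e|[e|[[e1 e2]|[e1 e2]]]] : p = b \/ q = b \/ (p = c /\ q = x) \/ (p = x /\ q = c).
  + by have := h1 _ _ tp; have := h2 _ _ tp; solve_eq unif.
  + by subst p; case: (slot _ tp).
  + by subst q; case: (slot _ (tri_swap23 tp)); rewrite setUAC.
  + by subst p q; case: kz.
  + by subst p q; case: kz; rewrite setUAC.
have vQ' : v \notin Q'.
  apply/negP=> vQ'; case: QQ'; apply: assigned_meet vQ vQ' => //.
  by exists b, c.
have [d [e [f [[dQ [eQ fQ]] [[db [eb fb]] [de [df ef]]]]]]] : exists d e f,
    (d \in Q' /\ e \in Q' /\ f \in Q') /\ (d <> b /\ e <> b /\ f <> b) /\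
    (d <> e /\ d <> f /\ e <> f).
  have [bQ'|bQ'] := boolP (b \in Q').
    have [d [e [f [_ [? [bd [be [bf [? [? ?]]]]]]]]]] := isK4_split kQ' bQ'.
    by exists d, e, f; do !split=> //; exact: nesym.
  have [g gQ'] : exists g, g \in Q' by apply/card_gt0P; case: kQ' => ->.
  have [d [e [f [_ [[dQ [eQ fQ]] [_ [_ [_ ?]]]]]]]] := isK4_split kQ' gQ'.
  exists d, e, f; do !split=> //; try tauto; move=> E; subst; move/negP: bQ'; exact.
have outV u : u \in Q' -> u \in V /\ u <> v.
  move=> uQ; split; last by move=> E; subst; rewrite uQ in vQ'.
  have [p [q [r [_ [[pQ [qQ _]] [up [uq [_ [pq _]]]]]]]]] := isK4_split kQ' uQ.
  by case: (tri_inV (tQ' _ _ _ uQ pQ qQ up uq pq)).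
have [dV dv] := outV _ dQ; have [eV ev] := outV _ eQ; have [fV fv] := outV _ fQ.
have [h|[h|h]] := isK4_T1 kQ' dQ eQ fQ de df ef.
- by have := h _ _ (tri_rotr (tvbz d dV dv db)); split_eq.
- by have := h _ _ (tri_rotr (tvbz e eV ev eb)); split_eq.
- by have := h _ _ (tri_rotr (tvbz f fV fv fb)); split_eq.
Qed.

(** The four triples have point reasons and no point serves twice, by [no_double]; so each of the
    four points serves once. *)
Lemma all_assigned Q Q' v : isK4 F Q -> isK4 F Q' -> Q <> Q' -> v \in Q ->
  assigned Q v.
Proof.
move=> kQ kQ' QQ' vQ.
have [b [c [x [_ [[bQ [cQ xQ]] [vb [vc [vx [bc [bx cx]]]]]]]]]] := isK4_split kQ vQ.
have H1 := isK4_T1 kQ vQ bQ cQ vb vc bc; have H2 := isK4_T1 kQ vQ bQ xQ vb vx bx.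
have H3 := isK4_T1 kQ vQ cQ xQ vc vx cx; have H4 := isK4_T1 kQ bQ cQ xQ bc bx cx.
have bv := nesym vb; have cv := nesym vc; have xv := nesym vx.
have cb := nesym bc; have xb := nesym bx; have xc := nesym cx.
have nd := no_double kQ kQ' QQ'.
have b1 := nd b v c x bQ vQ cQ xQ bv bc bx vc vx cx.
have b2 := nd b c v x bQ cQ vQ xQ bc bv bx cv cx vx.
have b3 := nd b x v c bQ xQ vQ cQ bx bv bc xv xc vc.
have c1 := nd c v b x cQ vQ bQ xQ cv cb cx vb vx bx.
have c2 := nd c b v x cQ bQ vQ xQ cb cv cx bv bx vx.
have c3 := nd c x v b cQ xQ vQ bQ cx cv cb xv xb vb.
have x1 := nd x v b c xQ vQ bQ cQ xv xb xc vb vc bc.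
have x2 := nd x b v c xQ bQ vQ cQ xb xv xc bv bc vc.
have x3 := nd x c v b xQ cQ vQ bQ xc xv xb cv cb vb.
have sw p q r := @T1_swap _ F p q r.
have B1 := sw b v c; have B2 := sw b v x; have B3 := sw b c x.
have C1 := sw c v b; have C2 := sw c v x; have C3 := sw c b x.
have X1 := sw x v b; have X2 := sw x v c; have X3 := sw x b c.
have [h|[h|h]] : T1 v b c \/ T1 v b x \/ T1 v c x.
- clear -H1 H2 H3 H4 b1 b2 b3 c1 c2 c3 x1 x2 x3 B1 B2 B3 C1 C2 C3 X1 X2 X3; tauto.
- by exists b, c.
- by exists b, x.
- by exists c, x.
Qed.

Lemma isK4_disjoint Q Q' v : isK4 F Q -> isK4 F Q' -> Q <> Q' -> v \in Q ->
  v \notin Q'.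
Proof.
move=> kQ kQ' QQ' vQ; apply/negP=> vQ'; case: (QQ').
by apply: (assigned_meet kQ kQ' _ vQ vQ'); exact: (all_assigned kQ kQ').
Qed.

Lemma isK4_subV Q v : isK4 F Q -> v \in Q -> v \in V.
Proof.
move=> kQ vQ; have [_ tQ] := kQ.
have [p [q [r [_ [[pQ [qQ _]] [up [uq [_ [pq _]]]]]]]]] := isK4_split kQ vQ.
by case: (tri_inV (tQ _ _ _ vQ pQ qQ up uq pq)).
Qed.

Lemma isK4_edge Q v w z : isK4 F Q -> v \in Q -> w \in Q -> z \notin Q -> t v w z ->
  T1 z v w \/ T2 v z w \/ T2 w z v.
Proof.
move=> kQ vQ wQ zQ tvwz; have [_ tQ] := kQ.
have [vw vz wz] := tri_neq unif tvwz.
have inQ u : u \in Q -> u <> z by move=> uQ e; subst u; rewrite uQ in zQ.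
have [p' [q' [p'Q [q'Q [wp [wq [vp' [vq' pq']]]]]]]] : exists p' q',
    p' \in Q /\ q' \in Q /\ w <> p' /\ w <> q' /\ v <> p' /\ v <> q' /\ p' <> q'.
  have [r [s [u [_ [[rQ [sQ uQ]] [vr [vs [vu [rs [ru su]]]]]]]]]] := isK4_split kQ vQ.
  have [e|/eqP wr] := eqVneq w r; first by exists s, u; subst; do !split=> //.
  have [e|/eqP ws] := eqVneq w s; first by exists r, u; subst; do !split=> //.
  by exists r, s; do !split=> //.
have [pz qz] := (inQ _ p'Q, inQ _ q'Q).
case: (reason unif uns tvwz) => [/(no_T0 tvwz)//|[[h|[h|h]]|[h|[h|h]]]].
- by have := h _ _ (tQ _ _ _ vQ p'Q q'Q vp' vq' pq'); split_eq.
- by have := h _ _ (tQ _ _ _ wQ p'Q q'Q wp wq pq'); split_eq.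
- by left.
- by have := h _ (tQ _ _ _ vQ wQ p'Q vw vp' wp); split_eq.
- by right; left.
- by right; right.
Qed.

(** Ordered pairs are summed and the diagonal contributes nothing, so this is twice the number of
    link edges of [z] inside [Q]. *)
Definition weight (Q : {set T}) z := \sum_(v in Q) \sum_(w in Q) (tri F v w z : nat).

Lemma sum4 (f : T -> nat) a b c x : a <> b -> a <> c -> a <> x -> b <> c -> b <> x ->
  c <> x -> \sum_(v in [set a; b; c; x]) f v = f a + f b + f c + f x.
Proof.
move=> /eqP ab /eqP ac /eqP ax /eqP bc /eqP bx /eqP cx.
rewrite -!setUA big_setU1 /=; last by rewrite !inE !negb_or ab ac ax.
rewrite big_setU1 /=; last by rewrite !inE negb_or bc bx.
by rewrite big_setU1 /= ?big_set1 ?addnA // inE.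
Qed.

(** In the graph that the link of [z] induces on [Q], the triple assigned to a vertex excludes its
    edge to the fourth point: degrees are at most 2, so there are at most 4 edges. If [z] is not a
    reason, [isK4_edge] gives each edge an end of degree 1, leaving at most 2 edges. *)
Lemma weight_le8 Q Q' z : isK4 F Q -> isK4 F Q' -> Q <> Q' -> z \notin Q -> 
  weight Q z <= 8 /\ (weight Q z <= 4 \/
    exists v w, [/\ v \in Q, w \in Q & T1 z v w]).
Proof.
move=> kQ kQ' QQ' zQ.
have [a aQ] : exists a, a \in Q by apply/card_gt0P; case: kQ => ->.
have [b [c [x [eQ [[bQ [cQ xQ]] [ab [ac [ax [bc [bx cx]]]]]]]]]] := isK4_split kQ aQ.
have inQ u : u \in Q -> u <> z by move=> uQ e; subst u; rewrite uQ in zQ.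
have [[az bz] [cz xz]] := ((inQ _ aQ, inQ _ bQ), (inQ _ cQ, inQ _ xQ)).
have irr u : tri F u u z = false.
  by apply/negP=> /(tri_neq unif)[].
have symm u v : tri F u v z = tri F v u z by apply/idP/idP; exact: tri_swap12.
have deg2 v : v \in Q -> exists2 w, w \in Q /\ w <> v & ~~ tri F v w z.
  move=> vQ; have [p [q [pQ qQ [vp [vq pq]] h]]] := all_assigned kQ kQ' QQ' vQ.
  have [r [_ [rQ [rv [rp rq]]]]] := isK4_fourth kQ vQ pQ qQ vp vq pq.
  exists r => //; apply/negP=> /h; have := inQ _ pQ; have := inQ _ qQ; split_eq.
have dom u : u \in Q -> u = a \/ u = b \/ u = c \/ u = x.
  by rewrite eQ !inE => /orP[/orP[/orP[]|]|] /eqP; tauto.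
have da : ~~ [&& tri F a b z, tri F a c z & tri F a x z].
  have [w [/dom wQ wv] n] := deg2 _ aQ; apply/and3P=> -[h1 h2 h3].
  by case/negP: n; case: wQ => [|[|[]]] e; subst.
have db : ~~ [&& tri F a b z, tri F b c z & tri F b x z].
  have [w [/dom wQ wv] n] := deg2 _ bQ; apply/and3P=> -[h1 h2 h3].
  by case/negP: n; case: wQ => [|[|[]]] e; subst=> //; exact: tri_swap12.
have dc : ~~ [&& tri F a c z, tri F b c z & tri F c x z].
  have [w [/dom wQ wv] n] := deg2 _ cQ; apply/and3P=> -[h1 h2 h3].
  by case/negP: n; case: wQ => [|[|[]]] e; subst=> //; exact: tri_swap12.
have dx : ~~ [&& tri F a x z, tri F b x z & tri F c x z].
  have [w [/dom wQ wv] n] := deg2 _ xQ; apply/and3P=> -[h1 h2 h3].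
  by case/negP: n; case: wQ => [|[|[]]] e; subst=> //; exact: tri_swap12.
have -> : weight Q z = (tri F a b z + tri F a c z + tri F a x z + tri F b c z +
    tri F b x z + tri F c x z).*2.
  rewrite /weight eQ !sum4 // !irr (symm b a) (symm c a) (symm x a).
  by rewrite (symm c b) (symm x b) (symm x c); lia.
split; first by move: da db dc dx; do 6 case: (tri F _ _ z).
have edge u v p q : u \in Q -> v \in Q -> u <> p -> u <> q -> v <> p -> v <> q ->
    (tri F u v z ==> (~~ tri F u p z && ~~ tri F u q z) ||
      (~~ tri F p v z && ~~ tri F q v z)) \/
    (exists v w, [/\ v \in Q, w \in Q & T1 z v w]).
  move=> uQ vQ up uq vp vq; case tuv: (tri F u v z); last by left.
  have [h|[h|h]] := isK4_edge kQ uQ vQ zQ tuv; [by right; exists u, v | left | left].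
  - apply/orP; left; apply/andP.
    by split; apply/negP=> /tri_swap23/h e; [case: vp | case: vq].
  - apply/orP; right; apply/andP.
    by split; apply/negP=> /tri_swap12/tri_swap23/h e; [case: up | case: uq].
have [ba [ca xa]] := (nesym ab, (nesym ac, nesym ax)).
have [cb [xb xc]] := (nesym bc, (nesym bx, nesym cx)).
have [e1|] := edge a b c x aQ bQ ac ax bc bx; last by right.
have [e2|] := edge a c b x aQ cQ ab ax cb cx; last by right.
have [e3|] := edge a x b c aQ xQ ab ac xb xc; last by right.
have [e4|] := edge b c a x bQ cQ ba bx ca cx; last by right.
have [e5|] := edge b x a c bQ xQ ba bc xa xc; last by right.
have [e6|] := edge c x a b cQ xQ ca cb xa xb; last by right.
left; move: e1 e2 e3 e4 e5 e6 da db dc dx.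
rewrite (symm b a) (symm c a) (symm c b) (symm x b) (symm x c).
by do 6 case: (tri F _ _ z).
Qed.

(** The triple of [Q'] assigned to [v] would force [p] or [q] into [Q'], which is disjoint from
    [Q]. *)
Lemma crossing Q Q' v p q : isK4 F Q -> isK4 F Q' -> Q <> Q' -> v \in Q' ->
  p \in Q -> q \in Q -> ~~ t v p q.
Proof.
move=> kQ kQ' QQ' vQ pQ qQ; have Q'Q := nesym QQ'.
have disj u : u \in Q -> u \in Q' -> False.
  by move=> uQ; apply/negP; exact: (isK4_disjoint kQ kQ').
have [b [c [bQ cQ _ h]]] := all_assigned kQ' kQ Q'Q vQ.
by apply/negP=> /h [[]|[]] e; [apply: (disj p)|apply: (disj p)|apply: (disj q)|apply: (disj q)]=> //;
  rewrite e.
Qed.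

(** As [v] is assigned, each member through it has a second point in [Q]. The third point lies in
    [Q], giving three triples, or outside both K4s, since [crossing] excludes [Q']. *)
Lemma degree_weight Q Q' v : isK4 F Q -> isK4 F Q' -> Q <> Q' -> v \in Q ->
  #|[set S in F | v \in S]| <=
    3 + \sum_(z in V :\: (Q :|: Q')) \sum_(w in Q) (tri F v w z : nat).
Proof.
move=> kQ kQ' QQ' vQ; have [Q4 tQ] := kQ.
pose Z := V :\: (Q :|: Q').
pose X := [set p : T * T | (p.1 \in Z) && (p.2 \in Q) && tri F v p.2 p.1].
have cX : #|X| = \sum_(z in Z) \sum_(w in Q) (tri F v w z : nat).
  rewrite pair_big /= -sum1_card big_mkcond [RHS]big_mkcond /=.
  apply: eq_bigr => -[z w] _; rewrite !inE /=.
  by case: (_ && (w \in Q)) => //=; case: (tri _ _ _ _).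
rewrite -cX.
pose X1 := [set Q :\ w | w in Q :\ v]; pose X2 := [set [set v; p.2; p.1] | p in X].
have cX1 : #|X1| <= 3.
  have h : #|X1| <= #|Q :\ v| := leq_imset_card _ _.
  by move: Q4; rewrite (cardsD1 v) vQ; lia.
have cX2 : #|X2| <= #|X| := leq_imset_card _ _.
apply: leq_trans (leq_add cX1 cX2).
apply: (leq_trans _ (leq_card_setU X1 X2)); apply/subset_leq_card/subsetP=> S.
rewrite inE => /andP[SF vS].
suff main x y : t v x y -> x \in Q -> [set v; x; y] \in X1 :|: X2.
  have [x [y e]] := triP unif SF vS; subst S; have tv : t v x y by [].
  have [b [c [bQ cQ _ h]]] := all_assigned kQ kQ' QQ' vQ.
  by case: (h _ _ tv) => -[] e; subst; [| | rewrite setUAC | rewrite setUAC];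
    apply: main => //; exact: tri_swap23.
move=> tv xQ; have [vx vy xy] := tri_neq unif tv; have [_ _ yV] := tri_inV tv.
rewrite inE; have [yQ|yQ] := boolP (y \in Q).
  apply/orP; left.
  have [w [eQ [wQ [wv [wx wy]]]]] := isK4_fourth kQ vQ xQ yQ vx vy xy.
  apply/imsetP; exists w; first by rewrite !inE wQ andbT; apply/eqP.
  apply/setP=> u; rewrite eQ !inE; have [->|/eqP uw] := eqVneq u w; last by rewrite orbF.
  by rewrite orbT /=; apply/negbTE; rewrite !negb_or; do !(apply/andP; split); apply/eqP.
apply/orP; right; apply/imsetP; exists (y, x) => //; rewrite !inE /= xQ yV negb_or yQ.
rewrite -/(tri F v x y) (tv : tri F v x y) !andbT.
apply/negP=> yQ'; have := crossing kQ kQ' QQ' yQ' vQ xQ.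
by rewrite (tri_rotr tv).
Qed.

Lemma isK4_unique Q Q' : isK4 F Q -> isK4 F Q' -> Q = Q'.
Proof.
move=> kQ kQ'; have [//|/eqP QQ'] := eqVneq Q Q'; exfalso.
have disj u : u \in Q -> u \notin Q' by exact: (isK4_disjoint kQ kQ').
pose Z := V :\: (Q :|: Q').
have cU : #|Q :|: Q'| = 8.
  have [[c1 _] [c2 _]] := (kQ, kQ').
  move: (cardsUI Q Q'); rewrite c1 c2 (_ : Q :&: Q' = set0) ?cards0 ?addn0 //.
  by apply/setP=> u; rewrite !inE; case uQ: (u \in Q) => //=; apply/negbTE/disj.
have cZ : #|Z| + 8 = #|V|.
  rewrite -cU addnC -(cardsID (Q :|: Q') V) (setIidPr _) // subUset.
  by apply/andP; split; apply/subsetP=> u;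
    [exact: (isK4_subV kQ) | exact: (isK4_subV kQ')].
have sumdeg P P' : isK4 F P -> isK4 F P' -> P <> P' -> V :\: (P :|: P') = Z ->
    4 * #|V|.-1 <= 12 + \sum_(z in Z) weight P z.
  move=> kP kP' PP' eZ; have [cP _] := kP.
  rewrite -[X in X * _]cP -[12]/(4 * 3) -[X in _ <= X * 3 + _]cP.
  rewrite -!sum_nat_const exchange_big -big_split /=; apply: leq_sum => v vP.
  apply: leq_trans (deg (isK4_subV kP vP)) _.
  by rewrite -eZ; exact: degree_weight.
have h1 := sumdeg _ _ kQ kQ' QQ' erefl.
have h2 : 4 * #|V|.-1 <= 12 + \sum_(z in Z) weight Q' z.
  by apply: (sumdeg _ Q) => //; [exact: nesym | rewrite setUC].
(* Adding the two degree sums would give 8(|V|-1) at most 24 + 8(|V|-8). *)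
suff h3 : \sum_(z in Z) weight Q z + \sum_(z in Z) weight Q' z <= #|Z| * 8 by lia.
rewrite -big_split -sum_nat_const /=; apply: leq_sum => z.
rewrite !inE negb_or => /andP[/andP[zQ zQ'] zV].
(* If all members through [z] meet a pair inside [P], none has its other two points in [P']. So a
   weight above 4 on one side makes the other weight 0. *)
have no_edge P P' : isK4 F P -> isK4 F P' -> P <> P' -> 
    (exists v w, [/\ v \in P, w \in P & T1 z v w]) -> weight P' z = 0.
  move=> kP kP' PP' [v [w [vP wP h]]].
  rewrite /weight big1 // => p pP; rewrite big1 // => q qP.
  apply/eqP; rewrite eqb0; apply/negP=> /tri_rotr/h.
  have disj' u : u \in P -> u \in P' -> False.
    by move=> uP; apply/negP; exact: (isK4_disjoint kP kP').
  by case=> -[] e; [apply: (disj' p)|apply: (disj' p)|apply: (disj' q)|apply: (disj' q)]=> //;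
    rewrite e.
have [w1 [w1'|e]] := weight_le8 kQ kQ' QQ' zQ; last first.
  by rewrite (no_edge _ _ kQ kQ' QQ' e); lia.
have [w2 [w2'|e]] := weight_le8 kQ' kQ (nesym QQ') zQ'; last first.
  by rewrite (no_edge _ _ kQ' kQ (nesym QQ') e); lia.
lia.
Qed.

Lemma core_isK4 A : A \subset F -> core A -> A != set0 ->
  exists Q, isK4 A Q /\ isK4 F Q.
Proof.
move=> AF cA /set0Pn[S SA].
have AtF x y z : tri A x y z -> t x y z by exact: (subsetP AF).
have [a [b [c e]]] := triP0 unif (subsetP AF _ SA); subst S.
have [x [xa [xb [xc [t1 t2 t3]]]]] := core_K4 unif uns AF cA no_T0 link_triangle SA.
have t0 : tri A a b c by [].
have [/eqP ab /eqP ac /eqP bc] := tri_neq unif (AtF _ _ _ t0).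
have /eqP ax := nesym xa; have /eqP bx := nesym xb; have /eqP cx := nesym xc.
have kA : isK4 A [set a; b; c; x].
  split; first by rewrite -!setUA !cardsU1 cards1 !inE !negb_or ab ac ax bc bx cx.
  move=> p q r; rewrite !inE.
  move=> /orP[/orP[/orP[]|]|] /eqP-> /orP[/orP[/orP[]|]|] /eqP->
    /orP[/orP[/orP[]|]|] /eqP-> // *; perm3.
exists [set a; b; c; x]; split=> //; have [Q4 tQ] := kA.
by split=> // p q r *; apply/AtF/tQ.
Qed.
End K4s.

Lemma large_contradiction :
  (forall S0, S0 \in F ->
     exists A, [/\ A \subset F, A != set0, S0 \notin A & core A]) ->
  F = set0.
Proof.
move=> cores; apply/eqP; apply: contraT => /set0Pn[S SF].
have no_T0 a b c : t a b c -> ~ T0 a b c.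
  move=> tabc h0; have [A [AF An SA cA]] := cores _ tabc.
  case: (T0_config unif uns AF cA h0 tabc An SA) => [h|[h|[h|h]]].
  - by case: (no_two_full).
  - by case: (no_coloured_T0).
  - by case: (no_coloured_T1).
  - by case: (no_coloured_T1').
have [A [AF An _ cA]] := cores _ SF.
have [Q [kA kQ]] := core_isK4 no_T0 AF cA An.
have [Q4 tA] := kA.
have [a aQ] : exists a, a \in Q by apply/card_gt0P; rewrite Q4.
have [b [c [x [_ [[bQ [cQ _]] [ab [ac [_ [bc _]]]]]]]]] := isK4_split kQ aQ.
have tabc : t a b c by apply: (subsetP AF); exact: tA.
(* [A'] avoids the triple abc of [Q], yet the K4 inside [A'] must be [Q]. *)
have [A' [AF' An' nA' cA']] := cores _ tabc.
have [Q' [kA' kQ']] := core_isK4 no_T0 AF' cA' An'.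
have QQ' := isK4_unique no_T0 kQ kQ'; subst Q'.
by case/negP: nA'; case: kA' => _; apply.
Qed.

End LargeDegrees.

(** * Seven points *)

Fixpoint mask_diff (m1 m2 : seq bool) :=
  match m1, m2 with
  | b1 :: m1', b2 :: m2' => (b1 && ~~ b2) :: mask_diff m1' m2'
  | _, _ => m1
  end.

Fixpoint mask_meet (m1 m2 : seq bool) :=
  match m1, m2 with
  | b1 :: m1', b2 :: m2' => (b1 && b2) || mask_meet m1' m2'
  | _, _ => false
  end.

(* Conditionals replace [||] because vm_compute evaluates both arguments. *)
Fixpoint search (target : nat) (av inc : seq bool)
    (todo : seq (nat * seq (seq bool))) : bool :=
  if count id av < target then true else
  if todo is (s, ks) :: todo' then
    if nth false av s then
      if has (fun k => ~~ mask_meet k av) ks then search target av inc todo'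
      else
        all (fun k => if mask_meet k inc then true else
          search target (mask_diff av k) (set_nth false inc s true) todo') ks &&
        (if nth false inc s then true else
          search target (set_nth false av s false) inc todo')
    else search target av inc todo'
  else false.

Lemma nth_mask_diff m1 m2 i :
  nth false (mask_diff m1 m2) i = nth false m1 i && ~~ nth false m2 i.
Proof.
by elim: m1 m2 i => [|b1 m1 IH] [|b2 m2] [|i] //=; rewrite ?nth_nil ?andbT.
Qed.

Lemma mask_meetP m1 m2 :
  mask_meet m1 m2 -> exists2 i, nth false m1 i & nth false m2 i.
Proof.
elim: m1 m2 => [|b1 m1 IH] [|b2 m2] //= /orP[/andP[? ?]|/IH[i ? ?]].
  by exists 0.
by exists i.+1.
Qed.

Lemma count_le_mask (f : pred nat) m n :
  (forall i, f i -> nth false m i) -> count f (iota 0 n) <= count id m.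
Proof.
move=> fm.
have -> : count id m = size [seq i <- iota 0 (size m) | nth false m i].
  by rewrite size_filter -{1}[m](mkseq_nth false) /mkseq count_map.
rewrite -size_filter; apply: uniq_leq_size; first exact/filter_uniq/iota_uniq.
move=> i; rewrite !mem_filter => /andP[/fm mi _]; rewrite mi mem_iota /= add0n.
by rewrite ltnNge; apply: contraL mi => /(nth_default false) ->.
Qed.

(** [f] is the unknown family, between [inc] and [av]. Passing over a triple only forgets a
    constraint; when branching, the branch that fits [f] is that of an actual reason of [s], or that
    of [s] lying outside the family. *)
Lemma search_sound (f : pred nat) target av inc
    (todo : seq (nat * seq (seq bool))) n :
  (forall i, f i -> nth false av i) -> (forall i, nth false inc i -> f i) ->
  (forall s ks, (s, ks) \in todo -> f s ->
     exists2 k, k \in ks & forall i, nth false k i -> ~~ f i) ->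
  search target av inc todo -> count f (iota 0 n) < target.
Proof.
elim: todo av inc => [|[s ks] todo IH] av inc fav incf reasons /=.
  by case: ifP => // lt _; apply: leq_ltn_trans (count_le_mask n fav) lt.
have reasons' s' ks' : (s', ks') \in todo -> f s' ->
    exists2 k, k \in ks' & forall i, nth false k i -> ~~ f i.
  by move=> h; apply: reasons; rewrite inE h orbT.
case: ifP => [lt _|_]; first exact: leq_ltn_trans (count_le_mask n fav) lt.
case: ifP => [avs|_]; last exact: IH.
case: ifP => [_|_]; first exact: IH.
case/andP=> /allP hks hex; have [fs|nfs] := boolP (f s).
  have [k kks kf] := reasons s ks (mem_head _ _) fs.
  move: (hks _ kks); case: ifP => [/mask_meetP[i ki ii] _|_].
    by move: (kf _ ki); rewrite incf.
  apply: IH => // i; first by rewrite nth_mask_diff => fi; rewrite fav //=; apply: contraL fi => /kf.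
  by rewrite nth_set_nth /=; case: eqP => [-> //|_ /incf].
move: hex; case: ifP => [/incf|_]; first by rewrite (negPf nfs).
apply: IH => // i fi; rewrite nth_set_nth /=; case: eqP => [e|_]; last exact: fav.
by rewrite -e fi in nfs.
Qed.

(** * The search instances on seven points *)

Definition triples7 : seq (seq nat) :=
  [seq s <- [seq i :: s | i <- iota 0 7,
               s <- [seq [:: j; k] | j <- iota 0 7, k <- iota 0 7]] | sorted ltn s].

Definition kill (s b : seq nat) : seq bool :=
  [seq [seq x <- s | x \in s'] == b | s' <- triples7].

(** The whole of [s] is left out, since a member is its own trace. *)
Definition proper_subs (s : seq nat) : seq (seq nat) :=
  [seq mask m s | m <-
    [:: [:: false; false; false]; [:: true; false; false]; [:: false; true; false];
        [:: false; false; true]; [:: true; true; false]; [:: true; false; true];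
        [:: false; true; true]]].

(** All 35 triples start as available. Settled reasons are applied at once, so the search later
    passes over their members: the known reason excludes nothing more. *)
Definition initial_av (settled : seq (seq nat * seq nat)) :=
  foldr (fun p av => mask_diff av (kill p.1 p.2)) (nseq 35 true) settled.

(* [settled] lists members with a known reason, [inc] known members; a set of points
   is a list of numbers below 7, a family a mask over [triples7], and [kill s b] the
   mask of the triples excluded when [b] is the reason of [s]. *)
Definition search7 (settled : seq (seq nat * seq nat)) (inc : seq (seq nat)) :=
  search 17 (initial_av settled) [seq s \in inc | s <- triples7]
    [seq (index s triples7, [seq kill s b | b <- proper_subs s])
    | s <- inc ++ [seq s <- rev triples7 | s \notin inc]].

Lemma size_triples7 : size triples7 = 35. Proof. by vm_compute. Qed.

Lemma mem_triples7 s : s \in triples7 ->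
  [/\ size s = 3, uniq s & {subset s <= iota 0 7}].
Proof.
rewrite mem_filter => /andP[so /allpairsP[[i s'] [i7 /allpairsP[[j k] [j7 k7 e']] e]]].
simpl in e, e', i7, j7, k7; subst s' s; split=> //; first by apply: sorted_uniq so; [exact: ltn_trans | exact: ltnn].
by move=> x; rewrite 2!in_cons mem_seq1 => /or3P[] /eqP->.
Qed.

Lemma triples7_mem s : size s = 3 -> sorted ltn s -> {subset s <= iota 0 7} ->
  s \in triples7.
Proof.
case: s => [|i [|j [|k []]]] // _ so sub; rewrite mem_filter so andTb.
have [i7 j7 k7] : [/\ i \in iota 0 7, j \in iota 0 7 & k \in iota 0 7].
  by split; apply: sub; rewrite !inE eqxx ?orbT.
by apply/allpairsP; exists (i, [:: j; k]); split=> //; apply/allpairsP; exists (j, k).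
Qed.

(** The numbers 0 to 4 stand for a, b, c, z, z'. *)
Lemma search_two_full :
  search7 [:: ([:: 0; 1; 2], [::])]
    [:: [:: 0; 1; 2]; [:: 0; 1; 3]; [:: 0; 2; 3]; [:: 1; 2; 3];
        [:: 0; 1; 4]; [:: 0; 2; 4]; [:: 1; 2; 4]].
Proof. by vm_compute. Qed.

(** Here and in the next two searches 0 to 4 stand for a, b, c, z, w. *)
Lemma search_coloured_T0 :
  search7 [:: ([:: 0; 1; 2], [::]); ([:: 0; 3; 4], [::])]
    [:: [:: 0; 1; 2]; [:: 0; 3; 4]; [:: 1; 3; 4]].
Proof. by vm_compute. Qed.

Lemma search_coloured_T1 :
  search7 [:: ([:: 0; 1; 2], [::]); ([:: 0; 3; 4], [:: 3]); ([:: 1; 3; 4], [:: 3])]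
    [:: [:: 0; 1; 2]; [:: 0; 3; 4]; [:: 1; 3; 4]].
Proof. by vm_compute. Qed.

Lemma search_coloured_T1' :
  search7 [:: ([:: 0; 1; 2], [::]); ([:: 0; 3; 4], [:: 3]); ([:: 1; 3; 4], [:: 4])]
    [:: [:: 0; 1; 2]; [:: 0; 3; 4]; [:: 1; 3; 4]; [:: 0; 1; 3]; [:: 0; 1; 4]].
Proof. by vm_compute. Qed.

(** The numbers 0 to 3 stand for the points a, b, c, x of [no_T0_config]. *)
Lemma search_no_T0 :
  search7 [:: ([:: 0; 1; 2], [:: 0])] [:: [:: 0; 1; 2]; [:: 0; 1; 3]; [:: 0; 2; 3]].
Proof. by vm_compute. Qed.

Lemma foldr_and (T : eqType) (P : T -> Prop) (s : seq T) :
  foldr (fun x Q => P x /\ Q) True s -> forall x, x \in s -> P x.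
Proof.
by elim: s => //= y s IH [Py /IH h] x; rewrite inE => /orP[/eqP->//|/h].
Qed.

Lemma card_le_size (T : finType) (A : {set T}) (s : seq T) :
  {subset A <= s} -> #|A| <= size s.
Proof. by move=> As; apply: leq_trans (card_size s); apply/subset_leq_card/subsetP. Qed.

(** * From numbered points to the family *)

Section SevenPoints.
Variable T : finType.
Variables (F : {set {set T}}) (V : {set T}).
Implicit Types (A : {set {set T}}) (S B : {set T}).
Hypothesis unif : forall S, S \in F -> #|S| = 3.
Hypothesis uns : unshattered F.
Hypothesis sub : forall S, S \in F -> S \subset V.

Section Numbering.
Variable p : nat -> T.
Hypothesis pinj : {in iota 0 7 &, injective p}.
Hypothesis pV : forall x, x \in V -> exists2 i, i \in iota 0 7 & x = p i.

Definition points (s : seq nat) : {set T} := [set x in map p s].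

Lemma mem_points s i : {subset s <= iota 0 7} -> i \in iota 0 7 ->
  (p i \in points s) = (i \in s).
Proof.
move=> s7 i7; rewrite inE; apply/mapP/idP => [[j js /pinj e]|]; last by exists i.
by rewrite e // s7.
Qed.

Lemma pointsI s s' b : {subset s <= iota 0 7} -> {subset s' <= iota 0 7} ->
  [seq x <- s | x \in s'] = b -> points s' :&: points s = points b.
Proof.
move=> s7 s'7 <-; apply/setP=> x; rewrite in_setI andbC.
have [|xs] := boolP (x \in points s); last first.
  apply/esym/negbTE; apply: contra xs; rewrite !inE => /mapP[i].
  by rewrite mem_filter => /andP[_ ?] ->; exact: map_f.
rewrite inE => /mapP[i is_ ->] /=; have i7 := s7 _ is_.
rewrite !mem_points //; first by rewrite mem_filter is_ andbT.
by move=> j; rewrite mem_filter => /andP[_ /s7].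
Qed.

Let f i := (i < 35) && (points (nth [::] triples7 i) \in F).

Let nth_triples7 i : i < 35 -> nth [::] triples7 i \in triples7.
Proof. by move=> i35; rewrite mem_nth ?size_triples7. Qed.

(** Each member is [points] of the increasing list of its numbers, which occurs in [triples7]. *)
Lemma card_le_count : #|F| <= count f (iota 0 35).
Proof.
pose X := [seq points (nth [::] triples7 i) | i <- iota 0 35 & f i].
have -> : count f (iota 0 35) = size X by rewrite size_map size_filter.
apply: card_le_size => S SF.
pose s := [seq i <- iota 0 7 | p i \in S].
have s7 : {subset s <= iota 0 7} by move=> i; rewrite mem_filter => /andP[].
have eS : S = points s.
  apply/setP=> x; apply/idP/idP => [xS|].
    have [i i7 e] := pV (subsetP (sub SF) _ xS); subst x.
    by rewrite mem_points // mem_filter xS.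
  by rewrite inE => /mapP[i]; rewrite mem_filter => /andP[? _] ->.
have st : s \in triples7.
  apply: triples7_mem => //; last first.
    by apply: sorted_filter; [exact: ltn_trans | exact: iota_ltn_sorted].
  rewrite -(unif SF) eS cardsE (card_uniqP _) ?size_map //.
  by rewrite map_inj_in_uniq ?filter_uniq ?iota_uniq // => i j /s7 ? /s7 ?; exact: pinj.
apply/mapP; exists (index s triples7); last by rewrite nth_index.
by rewrite mem_filter mem_iota /f nth_index // -eS SF -size_triples7 index_mem st.
Qed.

Lemma kill_sound s b i : s \in triples7 -> misses F (points s) (points b) ->
  nth false (kill s b) i -> ~~ f i.
Proof.
move=> st mis k; apply/negP=> /andP[i35 SF].
move: k; rewrite (nth_map [::]) ?size_triples7 // => /eqP e.
have [_ _ s7] := mem_triples7 st; have [_ _ i7] := mem_triples7 (nth_triples7 i35).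
by move: (mis _ SF); rewrite (pointsI s7 i7 e) eqxx.
Qed.

Lemma search7_sound settled inc :
  (forall q, q \in settled -> q.1 \in triples7 /\ misses F (points q.1) (points q.2)) ->
  (forall s, s \in inc -> s \in triples7 /\ points s \in F) ->
  search7 settled inc -> #|F| < 17.
Proof.
move=> hs hi; move/(search_sound (f := f) 35) => h.
apply: leq_ltn_trans card_le_count (h _ _ _).
- move=> i fi; elim: settled hs {h} => [|q settled IH] hs.
    by rewrite nth_nseq; case/andP: fi => ->.
  rewrite nth_mask_diff IH => [|q' q's]; last by apply: hs; rewrite inE q's orbT.
  have [st mis] := hs q (mem_head _ _).
  by apply: contraL fi; exact: kill_sound.
- move=> i; have [i35|i35] := ltnP i 35; last by rewrite nth_default ?size_map ?size_triples7.
  by rewrite (nth_map [::]) ?size_triples7 // /f i35 => /hi[].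
move=> i ks /mapP[s so [-> ->]].
have st : s \in triples7.
  by move: so; rewrite mem_cat mem_filter mem_rev => /orP[/hi[]|/andP[]].
have [s3 su s7] := mem_triples7 st.
case/andP=> _; rewrite nth_index // => SF; have [B BS mis] := uns SF.
pose b := mask [seq p x \in B | x <- s] s.
have eB : B = points b.
  apply/setP=> x; rewrite /b -filter_mask; apply/idP/idP => [xB|].
    move: (subsetP BS _ xB); rewrite !inE => /mapP[i' i's e]; subst x.
    by rewrite map_f // mem_filter xB.
  by rewrite inE => /mapP[i']; rewrite mem_filter => /andP[? _] ->.
rewrite eB in mis; exists (kill s b); last by move=> i'; exact: kill_sound.
suff : b \in proper_subs s by move/(map_f (kill s)).
move: (mis _ SF); rewrite setIid /b.
case: s s3 {so st su s7 SF BS b eB mis} => [|x [|y [|z []]]] // _.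
rewrite /proper_subs /=.
by case: (p x \in B); case: (p y \in B); case: (p z \in B);
  rewrite ?in_cons ?eqxx ?orbT.
Qed.

End Numbering.

Local Notation t := (tri F).

(** The points of a configuration come first, so that the fixed numbers used in a search denote
    them; the rest of [V] follows. *)
Lemma numbering (l : seq T) : #|V| = 7 -> uniq l -> {subset l <= V} ->
  exists r, let q := l ++ r in
    forall x0, {in iota 0 7 &, injective (nth x0 q)} /\
      (forall x, x \in V -> exists2 i, i \in iota 0 7 & x = nth x0 q i).
Proof.
move=> V7 ul lV; exists [seq x <- enum V | x \notin l]; cbv zeta => x0.
set q := l ++ _; have uq : uniq q.
  rewrite cat_uniq ul filter_uniq ?enum_uniq // andbT; apply/hasPn=> x.
  by rewrite mem_filter => /andP[].
have eqV : q =i V.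
  move=> x; rewrite mem_cat mem_filter mem_enum.
  by have [/lV->|] := boolP (x \in l).
have sq : size q = 7 by rewrite -V7 -(card_uniqP uq); exact: eq_card.
split=> [i j|x]; rewrite -?eqV.
  by rewrite !mem_iota -sq => i7 j7 /eqP; rewrite nth_uniq // => /eqP.
by move=> xq; exists (index x q); rewrite ?nth_index // mem_iota -sq index_mem.
Qed.

Lemma T0_misses a b c : T0 F a b c -> misses F [set a; b; c] set0.
Proof.
move=> h S SF; apply/set0Pn; have [x [y [z e]]] := triP0 unif SF; subst S.
by case: (h _ _ _ SF) => [|[]] [e|[e|e]];
  [exists x|exists x|exists x|exists y|exists y|exists y|exists z|exists z|exists z];
  rewrite !inE e !eqxx ?orbT.
Qed.

Lemma T1_misses a b c : T1 F a b c -> misses F [set a; b; c] [set a].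
Proof.
move=> h S SF; apply/eqP=> e.
have aS : a \in S by move/setP/(_ a): e; rewrite !inE !eqxx /= andbT.
have [x [y eS]] := triP unif SF aS; subst S.
have [ax ay _] := tri_neq unif SF.
have inS u : u \in [set a; x; y] -> u \in [set a; b; c] -> u = a.
  by move=> u1 u2; move/setP/(_ u): e; rewrite in_setI u1 u2 inE => /esym/eqP.
by case: (h _ _ SF) => -[] e'; [case: ax|case: ax|case: ay|case: ay];
  apply/esym/inS; rewrite !inE ?e' !eqxx ?orbT.
Qed.

(** 17 is C(6,2) + 2, the least size above the bound for seven points. *)
Lemma seven_contradiction :
  #|V| = 7 -> 17 <= #|F| ->
  (forall S0, S0 \in F ->
     exists A, [/\ A \subset F, A != set0, S0 \notin A & core A]) -> False.
Proof.
move=> V7 F17 cores.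
have F17' : ~ #|F| < 17 by apply/negP; rewrite -leqNgt.
have tV x y z : t x y z -> [/\ x \in V, y \in V & z \in V].
  by move/sub/subsetP=> h; split; apply: h; rewrite !inE eqxx ?orbT.
have points3 p i j k : points p [:: i; j; k] = [set p i; p j; p k].
  by apply/setP=> x; rewrite !inE orbA.
have points1 p i : points p [:: i] = [set p i] by apply/setP=> x; rewrite !inE.
have points0 p : points p [::] = set0 by apply/setP=> x; rewrite !inE.
have run l settled inc :
    search7 settled inc -> uniq l -> all (mem V) l ->
    all (mem triples7) inc -> all (fun q => q.1 \in triples7) settled ->
    ~ (forall p, (forall x0 i, i < size l -> p i = nth x0 l i) ->
      foldr (fun s P => points p s \in F /\ P) True inc /\
      foldr (fun q P => misses F (points p q.1) (points p q.2) /\ P) True settled).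
  move=> run ul /allP lV /allP hi /allP hs H.
  have /card_gt0P[x0 _] : 0 < #|V| by rewrite V7.
  have [r /(_ x0) [inj onto]] := @numbering l V7 ul lV.
  have [|/foldr_and Hi /foldr_and Hs] := H (nth x0 (l ++ r)).
    by move=> x1 i il; rewrite nth_cat il; exact: set_nth_default.
  apply: F17'; apply: (search7_sound inj onto _ _ run) => [q h|s h].
    by split; [exact: hs | exact: Hs].
  by split; [exact: hi | exact: Hi].
have five a b c z w settled inc : t a b c -> z \in V -> w \in V ->
    z <> a -> z <> b -> z <> c -> w <> a -> w <> b -> w <> c -> z <> w ->
    search7 settled inc ->
    all (mem triples7) inc -> all (fun q => q.1 \in triples7) settled ->
    ~ (forall p, p 0 = a -> p 1 = b -> p 2 = c -> p 3 = z -> p 4 = w ->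
      foldr (fun s P => points p s \in F /\ P) True inc /\
      foldr (fun q P => misses F (points p q.1) (points p q.2) /\ P) True settled).
  move=> tabc zV wV za zb zc wa wb wc zw sr hi hs H.
  have [ab ac bc] := tri_neq unif tabc; have [aV bV cV] := tV _ _ _ tabc.
  apply: (run [:: a; b; c; z; w] _ _ sr _ _ hi hs).
  - by rewrite /= !inE !negb_or; do !(apply/andP; split=> //); apply/eqP; congruence.
  - by rewrite /= aV bV cV zV wV.
  by move=> p hp; apply: H;
    [exact: (hp a 0)|exact: (hp a 1)|exact: (hp a 2)|exact: (hp a 3)|exact: (hp a 4)].
have no_T0 a b c : t a b c -> ~ T0 F a b c.
  move=> tabc h0; have [A [AF An SA cA]] := cores _ tabc.
  have cfg := T0_config unif uns AF cA h0 tabc An SA.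
  move: cfg; clear a b c tabc h0 A AF An SA cA; case.
    case=> a [b [c [z [z' [h0 tabc zz' [abz acz bcz] [abz' acz' bcz']]]]]].
    have [_ az bz] := tri_neq unif abz; have [_ _ cz] := tri_neq unif bcz.
    have [_ az' bz'] := tri_neq unif abz'; have [_ _ cz'] := tri_neq unif bcz'.
    have [_ _ zV] := tV _ _ _ abz; have [_ _ zV'] := tV _ _ _ abz'.
    apply: (five a b c z z' _ _ tabc zV zV' (nesym az) (nesym bz) (nesym cz)
      (nesym az') (nesym bz') (nesym cz') zz' search_two_full isT isT).
    move=> p p0 p1 p2 p3 p4; rewrite /= !points3 points0 p0 p1 p2 p3 p4.
    by do !split=> //; exact: T0_misses.
  case=> [|[]] [a [b [c [z [w [[h0 tabc [azw [bzw [zc wc]]]] tc]]]]]];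
    have [_ zV wV] := tV _ _ _ azw;
    have [az aw zw] := tri_neq unif azw; have [bz bw _] := tri_neq unif bzw;
    have coloured s inc := five a b c z w s inc tabc zV wV (nesym az) (nesym bz) zc
      (nesym aw) (nesym bw) wc zw.
  - apply: (coloured _ _ search_coloured_T0 isT isT) => p p0 p1 p2 p3 p4.
    rewrite /= !points3 points0 p0 p1 p2 p3 p4.
    by do !split=> //; exact: T0_misses.
  - apply: (coloured _ _ search_coloured_T1 isT isT) => p p0 p1 p2 p3 p4.
    rewrite /= !points3 points0 points1 p0 p1 p2 p3 p4; case: tc => h1 h2.
    do !split=> //; first exact: T0_misses.
      by rewrite [[set a; z]]setUC; exact: T1_misses.
    by rewrite [[set b; z]]setUC; exact: T1_misses.
  apply: (coloured _ _ search_coloured_T1' isT isT) => p p0 p1 p2 p3 p4.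
  rewrite /= !points3 points0 !points1 p0 p1 p2 p3 p4; case: tc => h1 h2 h3 h4.
  do !split=> //; first exact: T0_misses.
    by rewrite [[set a; z]]setUC; exact: T1_misses.
  by rewrite setUC setUA; exact: T1_misses.
have /card_gt0P[S SF] : 0 < #|F| by apply: leq_trans F17.
have [A [AF An _ cA]] := cores _ SF.
have [a [b [c [x [h xc tabc tabx tacx]]]]] := no_T0_config unif uns AF cA no_T0 An.
have [ab ac bc] := tri_neq unif tabc; have [aV bV cV] := tV _ _ _ tabc.
have [_ ax bx] := tri_neq unif tabx; have [_ _ xV] := tV _ _ _ tabx.
apply: (run [:: a; b; c; x] _ _ search_no_T0 _ _ isT isT).
- by rewrite /= !inE !negb_or; do !(apply/andP; split=> //); apply/eqP; congruence.
- by rewrite /= aV bV cV xV.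
move=> p hp; rewrite /= !points3 points1 (hp a 0) // (hp a 1) // (hp a 2) // (hp a 3) //=.
by do !split=> //; exact: T1_misses.
Qed.
End SevenPoints.

(** * Induction on the number of points *)

Lemma unshattered_card (T : finType) (V : {set T}) (F : {set {set T}}) :
  7 <= #|V| -> (forall S, S \in F -> #|S| = 3) ->
  (forall S, S \in F -> S \subset V) -> unshattered F ->
  #|F| <= 'C(#|V|.-1, 2) + 1.
Proof.
have [k] := ubnP #|V|; elim: k => // k IH in V F *.
move=> Vk V7 unif sub uns; rewrite leqNgt; apply/negP=> big.
(* Without [S0] there are still more than C(|V|-1,2) members, so the rest contains a core. *)
have cores S0 : S0 \in F ->
    exists A : {set {set T}}, [/\ A \subset F, A != set0, S0 \notin A & core A].
  move=> SF; have [||| A [AF An cA]] := @core_exists T (F :\ S0) V.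
  - by move=> S; rewrite inE => /andP[_ /unif].
  - by move=> S; rewrite inE => /andP[_ /sub].
  - by move: big; rewrite (cardsD1 S0 F) SF addn1 add1n ltnS.
  exists A; split=> //; first exact: subset_trans AF (subsetDl _ _).
  by apply/negP=> /(subsetP AF); rewrite !inE eqxx.
move: (V7); rewrite leq_eqVlt => /orP[/eqP V7'|V8].
  apply: (seven_contradiction unif uns sub _ _ cores) => //.
  by move: big; rewrite -V7' addn1.
have F0 : F = set0.
  (* If [v] had degree at most |V|-2, deleting it would leave at least C(|V|-2,2) + 2 members on
     |V|-1 points, against the induction hypothesis. *)
  apply: (large_contradiction unif uns sub V8 _ cores) => v vV.
  pose F' := [set S in F | v \notin S].
  have cV : #|V :\ v| = #|V|.-1 by rewrite (cardsD1 v V) vV.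
  have F'F S : S \in F' -> S \in F by rewrite inE => /andP[].
  have h : #|F'| <= 'C(#|V :\ v|.-1, 2) + 1.
    apply: IH; rewrite ?cV; try lia.
    - by move=> S /F'F/unif.
    - by move=> S; rewrite inE subsetD1 => /andP[/sub-> ->].
    - move=> S SF'; have [B BS mis] := uns _ (F'F _ SF').
      by exists B => // S' /F'F; exact: mis.
  have e : #|F| = #|[set S in F | v \in S]| + #|F'|.
    rewrite -(cardsID [set S : {set T} | v \in S] F); congr (_ + _); apply: eq_card => S;
      by rewrite !inE // andbC.
  have eC : 'C(#|V|.-1, 2) = 'C(#|V|.-2, 2) + #|V|.-2.
    by case: #|V| V8 => [|[|m]] // _; rewrite /= binS bin1.
  rewrite cV in h.
  move: big; rewrite e eC; move: h; lia.
by move: big; rewrite F0 cards0.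
Qed.

Theorem theorem1p2 (n : nat) (F : {set {set 'I_n}}) :
  7 <= n ->
  F \subset [set A : {set 'I_n} | #|A| == 3] ->
  VCdim F <= 2 ->
  #|F| <= 'C(n - 1, 2) + 1.
Proof.
move=> n7 /subsetP F3 vc.
have unif S : S \in F -> #|S| = 3 by move/F3; rewrite inE => /eqP.
have := @unshattered_card _ [set: 'I_n] F; rewrite cardsT card_ord subn1.
by apply=> //; exact: VCdim_unshattered vc.
Qed.
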